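(* Let $\Omega\subset\mathbb{R}^2$ be a bounded convex set with nonempty interior, let $\mathcal{U}_\Omega$ be the set of continuous concave functions $u$ on $\Omega$ with bounded gradient that vanish on $\partial\Omega$, let $f:\mathbb{R}^2\to\mathbb{R}$ be a continuous function that is twice differentiable at $(0,0)$, and let $F(u)=\int_\Omega f(\nabla u(x,y))\,dx\,dy$ for $u\in\mathcal{U}_\Omega$. If $f''(0,0)$ is indefinite and $\partial\Omega$ contains at most one singular point, then $u\equiv 0$ is not a local minimum (in the $C^1$ norm) of $F$ in $\mathcal{U}_\Omega$.
   Context: Functions in $\mathcal{U}_\Omega$ are understood as continuous concave functions $u:\overline{\Omega}\to\mathbb{R}$ with $u=0$ on $\partial\Omega$. Such a function is differentiable almost everywhere, and ''bounded gradient'' means that $|\nabla u|$ is bounded over all points of differentiability. The $C^1$ norm is $$\|u\|_{C^1}=\sup_{\Omega}|u|+\sup_{\Omega}|u_x|+\sup_{\Omega}|u_y|,$$ where the second and third suprema are taken over points where $u_x$, respectively $u_y$, exists. The function $u\equiv 0$ is a local minimum of $F$ in $\mathcal{U}_\Omega$ if there is $\delta>0$ such that $F(u)\ge F(0)$ for all $u\in\mathcal{U}_\Omega$ with $\|u\|_{C^1}<\delta$. $f''(0,0)$ denotes the second derivative (Hessian quadratic form) of $f$ at the origin; ''indefinite'' means it has one positive and one negative eigenvalue. A point $\xi\in\partial\Omega$ is singular if there is more than one line of support to $\Omega$ at $\xi$. *)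

(* Defs.v *)
From HB Require Import structures.
From mathcomp Require Import all_boot all_order all_algebra.
From mathcomp Require Import all_classical all_reals all_analysis.

Set Implicit Arguments.
Unset Strict Implicit.
Unset Printing Implicit Defensive.

Import Order.TTheory GRing.Theory Num.Theory.
Import numFieldNormedType.Exports.

Local Open Scope classical_set_scope.
Local Open Scope ring_scope.

Section plane.
Context {R : realType}.
Implicit Types (Omega L : set (R * R)) (u f : R * R -> R) (p v xi : R * R).

Definition leb2 : set (measurableTypeR R * measurableTypeR R) -> \bar R :=
  (@lebesgue_measure R \x @lebesgue_measure R)%E.

Definition dot p v : R := p.1 * v.1 + p.2 * v.2.

Definition basis2 (i : 'I_2) : R * R := if i == 0 then (1, 0) else (0, 1).

Definition grad u p : R * R := ('D_(basis2 0) u p, 'D_(basis2 1) u p).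

(* The derivative of f exists near p and is itself differentiable at p; linear
   forms on the plane are identified with their coordinate pairs. *)
Definition twice_differentiable_at f p : Prop :=
  (\forall q \near p, differentiable f q) /\ differentiable (grad f) p.

Definition hessian f p : 'M[R]_2 :=
  \matrix_(i < 2, j < 2) 'D_(basis2 j) (fun q => 'D_(basis2 i) f q) p.

Definition indefinite (H : 'M[R]_2) : Prop :=
  exists a b : R, [/\ 0 < a, b < 0, eigenvalue H a & eigenvalue H b].

Definition boundary Omega : set (R * R) := closure Omega `\` interior Omega.

Definition support_line Omega xi L : Prop :=
  exists v, [/\ v != 0,
    L = [set p | dot v (p - xi) = 0] &
    forall p, Omega p -> dot v (p - xi) <= 0].

Definition singular_point Omega xi : Prop :=
  boundary Omega xi /\
  exists L1 L2, [/\ support_line Omega xi L1, support_line Omega xi L2 &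
                    L1 <> L2].

(* Functions on closure Omega are represented by total functions; only their
   values on closure Omega matter below.  Derivatives are taken at interior
   points, so they do not depend on the values outside closure Omega; the rest
   of Omega lies in the boundary of a convex set and has measure zero. *)
Definition diff_points Omega u : set (R * R) :=
  [set p | interior Omega p /\ differentiable u p].

Definition partial_points Omega u (i : 'I_2) : set (R * R) :=
  [set p | interior Omega p /\ derivable u p (basis2 i)].

Definition concave_on (D : set (R * R)) u : Prop :=
  convex_function D (fun p => - u p).

Definition U_ Omega u : Prop :=
  [/\ {within closure Omega, continuous u},
      concave_on (closure Omega) u,
      [bounded grad u p | p in diff_points Omega u] &
      forall p, boundary Omega p -> u p = 0].

(* Extended suprema: unlike sup on R, ereal_sup gives no spurious value 0 on
   sets that are not bounded above. *)
Definition C1norm Omega u : \bar R :=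
  (ereal_sup [set `|u p|%:E | p in Omega]
   + ereal_sup [set `|'D_(basis2 0%R) u p|%:E | p in partial_points Omega u 0%R]
   + ereal_sup [set `|'D_(basis2 1%R) u p|%:E | p in partial_points Omega u 1%R])%E.

(* A concave function is differentiable at almost every interior point, so this
   is the integral over Omega of the almost everywhere defined f (grad u).  *)
Definition functional Omega f u : R :=
  \int[leb2]_(p in diff_points Omega u) f (grad u p).

Definition zero_is_local_min Omega f : Prop :=
  exists2 delta : R, 0 < delta &
    forall u, U_ Omega u -> (C1norm Omega u < delta%:E)%E ->
      functional Omega f (fun=> 0) <= functional Omega f u.

End plane.

(* Main.v *)
Require Import Defs.
From HB Require Import structures.
From mathcomp Require Import all_boot all_order all_algebra.
From mathcomp Require Import all_classical all_reals all_analysis.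
From mathcomp Require Import measurable_realfun ring lra.
Import Order.TTheory GRing.Theory Num.Theory.
Import numFieldNormedType.Exports.
Local Open Scope classical_set_scope.
Local Open Scope ring_scope.

Set Implicit Arguments.
Unset Strict Implicit.
Unset Printing Implicit Defensive.

(** Only one direction [w] on which the Hessian form [q] is negative matters; it
    comes from an eigenvector for the negative eigenvalue.  Of the two points of
    the boundary with a line of support orthogonal to [w], one is nonsingular:
    call it [xi].  Let [u] be the concave function whose graph is a cone over
    [Omega] with apex at height 1 above a point [xi + h d] close to [xi].  Since
    [xi] is nonsingular, the boundary is nearly straight around it, so the
    gradient of [u] is nearly parallel to [w] wherever it is large, and it has
    size [1 / h] on a strip of width [s] and height [h], where [s / h] can be
    made as large as we like.  Hence the integral of [q (grad u)] is negative
    for a suitable [h].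

    As the integral of [grad u] vanishes, the second order expansion of [f] at
    the origin turns this into [functional (eps u) < functional 0] for small
    [eps].  Both the vanishing of the integral of [grad u] and the almost
    everywhere differentiability of [u] follow by dominated convergence from
    the translation invariance of the integral of
    [n (V_n (p + v / n) - V_n p)], where [V_n] truncates [u] at height [L / n]
    so that nothing happens at the boundary of the support. *)

(** * Lebesgue measure on the plane *)

Section plane_measure.
Context {R : realType}.
Notation mR := (measurableTypeR R).

(** Lebesgue measure is determined by its values on half-open intervals, and a translation preserves
    their lengths. *)
Lemma lebesgue_measure_shift (c : R) (A : set R) : measurable A ->
  pushforward lebesgue_measure ((fun x => x + c) : _ -> mR) A =
  lebesgue_measure A.
Proof.
move=> mA; apply/esym/lebesgue_measure_unique => //=.
  exact: measurable_funD.
move=> _ _ [[a b]] _ <-.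
rewrite /pushforward.
have -> : (fun x : R => x + c) @^-1` `]a, b] = `]a - c, b - c]%classic.
  by apply/seteqP; split => x /=; rewrite !in_itv/= ltrBlDr lerBrDr.
rewrite !lebesgue_measure_itv/= !lte_fin ltrD2r.
by case: ifP => // _; rewrite -!EFinB; congr EFin; ring.
Qed.

Definition shift2 (v : R * R) (p : mR * mR) : mR * mR := (p.1 + v.1, p.2 + v.2).

Lemma measurable_shift2 v : measurable_fun setT (shift2 v).
Proof.
by apply: measurable_fun_pair; apply: measurable_funD.
Qed.

(** Uniqueness of the product measure reduces the claim to rectangles, where the shift acts on each
    factor separately. *)
Lemma leb2_shift v (A : set (mR * mR)) : measurable A ->
  pushforward (@leb2 R) (shift2 v) A = leb2 A.
Proof.
move=> mA; apply/esym.
apply: (@product_measure_unique _ _ _ _ _ _ _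
  (pushforward (@leb2 R) (shift2 v) : {measure set _ -> \bar R})) => //.
  exact: measurable_shift2.
move=> mS B C mB mC; 
transitivity (leb2 (((fun x : mR => x + v.1) @^-1` B) `*`
                    ((fun x : mR => x + v.2) @^-1` C))); first by [].
rewrite /leb2 product_measure1E; last 2 first.
- rewrite -[X in measurable X]setTI; exact: measurable_funD.
- rewrite -[X in measurable X]setTI; exact: measurable_funD.
by congr (_ * _)%E; exact: lebesgue_measure_shift.
Qed.

Lemma ge0_integral_shift2 v (h : mR * mR -> \bar R) :
  measurable_fun setT h -> (forall p, (0 <= h p)%E) ->
  (\int[leb2]_p h (shift2 v p) = \int[leb2]_p h p)%E.
Proof.
move=> mh h0; transitivity (\int[pushforward (@leb2 R) (shift2 v)]_p h p)%E.
  rewrite (ge0_integral_pushforward (measurable_shift2 v)) //.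
apply: eq_measure_integral; first exact: measurable_shift2.
by move=> mS A mA _; exact: leb2_shift.
Qed.

(** The sigma-algebra of the plane is built from measurable rectangles, so an open set is written as
    the countable union of the rational open boxes that it contains. *)
Lemma open_measurable2 (A : set (R * R)) : open A ->
  measurable (A : set (mR * mR)).
Proof.
move=> oA.
pose I := (rat * rat * rat * rat)%type.
pose B (i : I) : set (R * R) :=
  `]ratr i.1.1.1 : R, ratr i.1.1.2[%classic `*` `]ratr i.1.2 : R, ratr i.2[%classic.
have -> : A = \bigcup_(i in [set i | B i `<=` A]) B i.
  apply/seteqP; split => [p Ap|p [i /= iA] /iA//].
  have [e /= e0 eA] : exists2 e : R, 0 < e & ball p e `<=` A.
    by move: oA; rewrite openE => /(_ _ Ap) /nbhs_ballP.
  have [a1] : exists q : rat, ratr q \in `]p.1 - e, p.1[.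
    by apply: rat_in_itvoo; rewrite ltrBlDr ltrDl.
  have [b1] : exists q : rat, ratr q \in `]p.1, p.1 + e[.
    by apply: rat_in_itvoo; rewrite ltrDl.
  have [a2] : exists q : rat, ratr q \in `]p.2 - e, p.2[.
    by apply: rat_in_itvoo; rewrite ltrBlDr ltrDl.
  have [b2] : exists q : rat, ratr q \in `]p.2, p.2 + e[.
    by apply: rat_in_itvoo; rewrite ltrDl.
  rewrite !in_itv/= => /andP[h1 h2] /andP[h3 h4] /andP[h5 h6] /andP[h7 h8].
  exists (a1, b1, a2, b2); last by split; rewrite /= in_itv/= ?h1 ?h2 ?h3 ?h4 ?h5 ?h6 ?h7 ?h8.
  move=> q [/=]; rewrite !in_itv/= => /andP[k1 k2] /andP[k3 k4].
  apply: eA; split; rewrite /ball/= ltr_distlC; apply/andP; split; lra.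
rewrite bigcup_mkcond; apply: countable_bigcupT_measurable => [|i]; first exact: countableP.
case: ifPn => // _; apply: measurableX; exact: measurable_itv.
Qed.

Lemma continuous_measurable2 (h : R * R -> R) : continuous h ->
  measurable_fun setT (h : mR * mR -> R).
Proof.
move=> ch.
apply: (measurability _ (@RGenOpens.measurableE R)) => _ [_ [a [b ->]] <-].
rewrite setTI; apply: open_measurable2.
by apply: open_comp => //; exact: interval_open.
Qed.

End plane_measure.

(** * Gradients as linear forms *)

Section dot_calculus.
Context {R : realType}.
Implicit Types (g v p : R * R) (h : R * R -> R).

Lemma ord2P (i : 'I_2) : i = 0 \/ i = 1.
Proof. by case: i => -[|[|]]//= h; [left|right]; exact: val_inj. Qed.

Lemma norm_basis2 i : `|basis2 i| <= 1 :> R.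
Proof.
by rewrite /basis2; case: ifP; rewrite prod_normE/= ?normr0 ?normr1 ge_max ?lexx ?ler01.
Qed.

Lemma norm_Nbasis2 i : `|- basis2 i| <= 1 :> R.
Proof. by rewrite normrN norm_basis2. Qed.

Lemma dot_is_linear g : linear (dot g : R * R -> R^o).
Proof. by move=> a u v; rewrite /dot /= /GRing.scale /=; ring. Qed.

HB.instance Definition _ g :=
  GRing.isLinear.Build R (R * R)%type R^o *:%R (dot g) (dot_is_linear g).

Lemma dot_continuous g : continuous (dot g).
Proof.
move=> v; rewrite /dot; apply: cvgD; apply: cvgMr.
  exact: cvg_fst.
exact: cvg_snd.
Qed.

(** The differential is unique, so a first order estimate with the linear form [dot g] gives
    differentiability and all directional derivatives at once. *)
Lemma differentiable_dot h p g :
  (forall e : R, 0 < e -> \forall v \near (0 : R * R), `|h (v + p) - h p - dot g v| <= e * `|v|) ->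
  differentiable h p /\ forall v, 'D_v h p = dot g v.
Proof.
move=> hg.
have hE : h \o shift p = cst (h p) + dot g +o_ (0 : R * R) id.
  apply/eqaddoP => e e0; have := hg e e0; apply: filterS => v.
  suff -> : (h \o shift p - (cst (h p) + dot g)) v = h (v + p) - h p - dot g v by [].
  by transitivity (h (v + p) - (h p + dot g v)) => //; rewrite opprD addrA.
have dE := @diff_unique _ _ _ h (dot g) p (@dot_continuous g) hE.
have dh : differentiable h p.
  by apply/diff_locallyP; rewrite dE; split => //; exact: dot_continuous.
by split=> // v; rewrite deriveE// dE.
Qed.

Lemma derive_dot_grad h p v : differentiable h p -> 'D_v h p = dot (grad h p) v.
Proof.
move=> dh; have -> : v = v.1 *: basis2 0 + v.2 *: basis2 1 :> R * R.
  rewrite [LHS]surjective_pairing; congr pair; rewrite /basis2/= /GRing.scale/=; ring.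
rewrite deriveE// linearD !linearZ/= /dot/grad/= -!deriveE//.
by rewrite /GRing.scale/= !mulr1 !mulr0 addr0 add0r mulrC; congr (_ + _); rewrite mulrC.
Qed.

Lemma grad_near h p (e : R) : differentiable h p -> 0 < e ->
  \forall v \near (0 : R * R), `|h (v + p) - h p - dot (grad h p) v| <= e * `|v|.
Proof.
move=> dh e0; have /eqaddoP/(_ _ e0) := diff_locally dh.
apply: filterS => v; rewrite !fctE/= opprD addrA.
by rewrite -deriveE// derive_dot_grad.
Qed.

(** A bound on one side of [p] along a ray suffices, because differentiability makes the slope along
    the ray equal to [dot (grad h p) v]. This turns every concavity inequality below into a bound on
    the gradient. *)
Lemma dot_grad_ge h p v (c : R) : differentiable h p ->
  (exists2 t0 : R, 0 < t0 & forall t : R, 0 < t <= t0 -> h p + t * c <= h (p + t *: v)) ->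
  c <= dot (grad h p) v.
Proof.
move=> dh [t0 t00 hc]; rewrite leNgt; apply/negP => gc.
(* With this [e], the error [e * |v|] is strictly smaller than the supposed gap
   [c - dot (grad h p) v]. *)
pose e := (c - dot (grad h p) v) / (2 * (`|v| + 1)).
have v1 : 0 < `|v| + 1 by rewrite ltr_wpDl.
have e0 : 0 < e by rewrite divr_gt0// ?subr_gt0// mulr_gt0.
have /nbhs_ballP[d /= d0 hd] := grad_near dh e0.
pose t := Num.min t0 (d / (2 * (`|v| + 1))).
have t_gt0 : 0 < t by rewrite lt_min t00 divr_gt0// mulr_gt0.
have td : t * (`|v| + 1) < d.
  apply: (@le_lt_trans _ _ (d / 2)); last by rewrite ltr_pdivrMr// ltr_pMr// ltr1n.
  rewrite -ler_pdivlMr// -mulrA -invfM ge_min; apply/orP; right.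
  by rewrite mulrC.
have /hd/= : ball (0 : R * R) d (t *: v).
  rewrite -ball_normE/= sub0r normrN normrZ gtr0_norm//.
  by apply: le_lt_trans td; apply: ler_wpM2l; rewrite ?lerDl// ltW.
rewrite linearZ/= normrZ (gtr0_norm t_gt0) => hh.
have := hc t; rewrite t_gt0 ge_min lexx/= => /(_ isT); rewrite addrC => h2.
have : t * (c - dot (grad h p) v) <= e * (t * `|v|).
  apply: le_trans hh; apply: le_trans (ler_norm _); rewrite mulrBr lerB//.
  by rewrite lerBrDr [t *: v + p]addrC.
rewrite mulrCA ler_pM2l// leNgt => /negP; apply.
rewrite /e mulrAC ltr_pdivrMr ?mulr_gt0// ltr_pM2l ?subr_gt0//.
have := normr_ge0 v; lra.
Qed.

Lemma dot_grad_le h p v (c : R) : differentiable h p ->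
  (exists2 t0 : R, 0 < t0 & forall t : R, 0 < t <= t0 -> h (p + t *: v) <= h p + t * c) ->
  dot (grad h p) v <= c.
Proof.
move=> dh [t0 t00 hc].
have dN : differentiable (- h) p by exact: differentiableN.
have gN : grad (- h) p = - grad h p.
  by rewrite /grad !deriveN//; exact: diff_derivable.
have : - c <= dot (grad (- h) p) v.
  apply: dot_grad_ge => //; exists t0 => // t /hc; rewrite !fctE/=; lra.
by rewrite gN /dot/=; lra.
Qed.

End dot_calculus.

(** * One-sided derivatives of concave functions *)

Section one_sided_derivative.
Context {R : realType}.
Variables (U : R * R -> R) (L : R).
Hypotheses (L0 : 0 <= L) (U0 : forall p, 0 <= U p)
  (Ulip : forall p v, U (p + v) <= U p + L * `|v|)
  (Uconc : forall p q (s : R), 0 <= s <= 1 -> 0 < U p -> 0 < U q ->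
     s * U p + (1 - s) * U q <= U (s *: p + (1 - s) *: q)).
Implicit Types (p q v : R * R) (n : nat) (s t : R).

Let Ulip' p v : U p - L * `|v| <= U (p + v).
Proof. by rewrite lerBlDr -{1}(addrK v p) -(normrN v). Qed.

(** The point [p + s *: v] is the convex combination of [p + t *: v] and [p] with weight [s / t];
    denominators are cleared. Concavity is assumed between points of positivity, which accounts for
    the first two premises. *)
Lemma concave_slope p v s t : 0 < U p -> 0 < U (p + t *: v) -> 0 < s <= t ->
  s * (U (p + t *: v) - U p) <= t * (U (p + s *: v) - U p).
Proof.
move=> p0 t0 /andP[s0 st]; have tp : 0 < t by exact: lt_le_trans st.
have st1 : 0 <= s / t <= 1 by rewrite (divr_ge0 (ltW s0) (ltW tp))/= ler_pdivrMr// mul1r.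
have := Uconc st1 t0 p0.
have -> : (s / t) *: (p + t *: v) + (1 - s / t) *: p = p + s *: v.
  rewrite scalerDr scalerA divfK ?gt_eqF// scalerBl scale1r.
  by rewrite addrAC addrCA subrr addr0.
have ts : t * (s / t) = s by rewrite mulrCA divff ?gt_eqF// mulr1.
rewrite -(ler_pM2l tp) mulrDr [t * (s / t * _)]mulrA ts [t * ((1 - s / t) * _)]mulrA.
by rewrite mulrBr mulr1 ts; lra.
Qed.

Definition trunc n p := Num.max (U p - L / n.+1%:R) 0.
Definition dquot v n p : R :=
  n.+1%:R * (trunc n (p + n.+1%:R^-1 *: v) - trunc n p).

Lemma trunc_lip n p v : `|trunc n (p + v) - trunc n p| <= L * `|v|.
Proof.
have := Ulip p v; have := Ulip' p v; have := mulr_ge0 L0 (normr_ge0 v).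
rewrite /trunc ler_norml => h1 h2 h3.
rewrite !maxEle; move: (L / n.+1%:R) => c.
by case: ifPn; rewrite -?ltNge => h4; case: ifPn; rewrite -?ltNge => h5; apply/andP; split; lra.
Qed.

Lemma norm_dquot v n p : `|v| <= 1 -> `|dquot v n p| <= L.
Proof.
move=> v1; rewrite /dquot normrM ger0_norm// mulrC -ler_pdivlMr//.
apply: (le_trans (trunc_lip _ _ _)); apply: ler_wpM2l => //.
by rewrite normrZ ger0_norm// ler_piMr.
Qed.

(** One step of length at most [1 / n.+1] lifts [U] from 0 to at most the truncation level
    [L / n.+1], so the truncation vanishes at both ends. Hence [dquot] lives on the support of [U]
    although it is a difference of translates. *)
Lemma dquot_out v n p : `|v| <= 1 -> U p = 0 -> dquot v n p = 0.
Proof.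
move=> v1 p0; have := Ulip p (n.+1%:R^-1 *: v).
rewrite p0 add0r normrZ ger0_norm// => h.
have h' : U (p + n.+1%:R^-1 *: v) - L / n.+1%:R <= 0.
  rewrite subr_le0; apply: le_trans h _; apply: ler_wpM2l => //.
  by rewrite ler_piMr.
rewrite /dquot /trunc p0 (max_idPr h') (max_idPr _) ?subrr ?mulr0//.
by rewrite sub0r oppr_le0 divr_ge0.
Qed.

(** By concavity the slopes over the steps [1 / n.+1] increase with [n], and the Lipschitz bound
    caps them by [L]. Near a point of positivity the truncation is eventually inactive, so these
    slopes are the values of [dquot]. *)
Lemma concave_one_sided p v : `|v| <= 1 -> 0 < U p -> exists l,
  [/\ dquot v n p @[n --> \oo] --> l,
      exists2 t0 : R, 0 < t0 & forall t, 0 < t <= t0 -> U (p + t *: v) <= U p + t * l &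
      forall e : R, 0 < e -> exists2 t0 : R, 0 < t0 &
        forall t, 0 < t <= t0 -> U p + t * (l - e) <= U (p + t *: v)].
Proof.
move=> v1 p0.
(* Choose [n0] so that [2 * L / n0.+1 < U p]: one half pays for the displacement along [v], the
   other for the truncation level. *)
have [n0 n0P] : exists n0, forall n t, (n0 <= n)%N -> 0 <= t <= n.+1%:R^-1 ->
    L / n.+1%:R < U (p + t *: v).
  have L1 : 0 < 2 * L + 1 by rewrite ltr_wpDl// mulr_ge0.
  have [n0] := ltr_add_invr (divr_gt0 p0 L1).
  rewrite add0r ltr_pdivlMr// => hn0; exists n0 => n t nn0 /andP[t0 tn].
  have nn : n.+1%:R^-1 <= n0.+1%:R^-1 :> R by rewrite lef_pV2 ?posrE// ler_nat.
  have i0 : 0 < n.+1%:R^-1 :> R by rewrite invr_gt0.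
  apply: lt_le_trans (Ulip' p (t *: v)).
  rewrite normrZ ger0_norm//; have := normr_ge0 v; have := ler_piMr t0 v1.
  move=> h1 h2; have h3 : L * (t * `|v|) <= L * n.+1%:R^-1.
    by apply: ler_wpM2l => //; exact: le_trans h1 tn.
  have h4 : L * n.+1%:R^-1 <= L * n0.+1%:R^-1 by exact: ler_wpM2l.
  have i1 : 0 < n0.+1%:R^-1 :> R by rewrite invr_gt0.
  rewrite ltrBrDr; apply: le_lt_trans (_ : L / n0.+1%:R + L / n0.+1%:R < _); last first.
    by move: hn0 i1; move: (n0.+1%:R^-1) => c; lra.
  by rewrite lerD// (le_trans h3).
have npos n : 0 < n.+1%:R^-1 :> R by rewrite invr_gt0.
have Upos t : 0 <= t <= n0.+1%:R^-1 -> 0 < U (p + t *: v).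
  by move=> /(n0P _ _ (leqnn _)); apply: le_lt_trans; rewrite divr_ge0.
pose Q n := n.+1%:R * (U (p + n.+1%:R^-1 *: v) - U p).
(* Chord slopes decrease with the step: for [t] below [1 / n.+1] the slope is at least [Q n], and
   for [t] above it, by [Qlb], at most [Q n]. *)
have Qub t n : (n0 <= n)%N -> 0 < t <= n.+1%:R^-1 ->
    t * Q n <= U (p + t *: v) - U p.
  move=> nn0 /andP[t0 tn]; rewrite /Q mulrCA mulrC -ler_pdivlMr// [leRHS]mulrC.
  apply: concave_slope => //; rewrite ?t0//.
  by apply: Upos; rewrite ltW//= lef_pV2 ?posrE// ler_nat ltnS.
have Qlb t n : n.+1%:R^-1 <= t <= n0.+1%:R^-1 ->
    U (p + t *: v) - U p <= t * Q n.
  move=> /andP[nt tn0].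
  rewrite /Q mulrCA -ler_pdivrMl//; apply: concave_slope => //.
    by apply: Upos; rewrite tn0 (le_trans _ nt)// ltW.
  by rewrite npos.
have JQ n : (n0 <= n)%N -> dquot v n p = Q n.
  move=> nn0; rewrite /dquot /trunc /Q.
  have h1 : L / n.+1%:R < U p.
    by have := n0P n 0 nn0; rewrite scale0r addr0; apply; rewrite lexx ltW.
  have h2 : L / n.+1%:R < U (p + n.+1%:R^-1 *: v).
    by apply: n0P => //; rewrite lexx ltW.
  rewrite (max_idPl _) ?subr_ge0 ?ltW// (max_idPl _) ?subr_ge0 ?ltW//.
  by congr (_ * _); ring.
(* Monotonicity is established from [n0] on, hence the shifted sequence. *)
pose u n := Q (n + n0)%N.
have u_nd : nondecreasing_seq u.
  apply/nondecreasing_seqP => n; rewrite /u addSn.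
  have h : (n + n0).+2%:R^-1 <= (n + n0).+1%:R^-1 :> R.
    by rewrite lef_pV2 ?posrE// ler_nat.
  have := Qub (n + n0).+2%:R^-1 (n + n0)%N (leq_addl _ _).
  rewrite npos h => /(_ isT).
  by rewrite -(ler_pM2l (_ : 0 < (n + n0).+2%:R :> R))// mulrA divff// mul1r.
have u_cvg : cvgn u.
  apply: nondecreasing_is_cvgn => //; exists L => _ [n _ <-].
  rewrite /u -JQ ?leq_addl//; apply: (@le_trans _ _ `|dquot v (n + n0) p|); last exact: norm_dquot.
  exact: ler_norm.
have u_le n : u n <= limn u by exact: nondecreasing_cvgn_le.
exists (limn u); split.
- have := u_cvg; rewrite -(cvg_shiftn n0 (dquot v ^~ p)).
  apply: cvg_trans; apply: near_eq_cvg; near=> n.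
  by rewrite /u /= JQ// leq_addl.
- exists n0.+1%:R^-1 => // t /andP[t0 tn0].
  have [n hn] := ltr_add_invr t0; rewrite add0r in hn.
  rewrite -lerBlDl; apply: le_trans (Qlb t (n + n0)%N _) _.
    rewrite tn0 andbT; apply: le_trans (ltW hn).
    by rewrite lef_pV2 ?posrE// ler_nat ltnS leq_addr.
  by rewrite ler_pM2l//; exact: u_le.
- move=> e e0; have /cvgrPdist_lt/(_ _ e0)[n _ /(_ n (leqnn _))/=] := u_cvg.
  rewrite ltr_distlC => /andP[h _].
  exists (n + n0).+1%:R^-1 => // t tn; rewrite -lerBrDl.
  apply: le_trans (Qub _ _ (leq_addl n n0) tn); case/andP: tn => t0 _.
  by rewrite ler_pM2l//; exact: ltW h.
Unshelve. all: by end_near. Qed.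

(** For [|v| <= 1] this is the right derivative of [U] along [v] where [U] is positive, and 0 where
    [U] vanishes. Being an everywhere defined limit of measurable functions, it serves as a
    measurable substitute for the partial derivatives. *)
Definition dright v p : R := limn (dquot v ^~ p).

Lemma dquot_cvg v p : `|v| <= 1 -> dquot v n p @[n --> \oo] --> dright v p.
Proof.
move=> v1; have := U0 p; rewrite le_eqVlt => /predU1P[p0|p0].
  have h : dquot v n p @[n --> \oo] --> (0 : R).
    by under eq_fun do rewrite dquot_out//; exact: cvg_cst.
  by rewrite /dright (cvg_lim _ h).
have [l [h _ _]] := concave_one_sided v1 p0.
by rewrite /dright (cvg_lim _ h).
Qed.

Lemma dright_out v p : `|v| <= 1 -> U p = 0 -> dright v p = 0.
Proof.
move=> v1 p0; rewrite /dright; apply: cvg_lim => //.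
by under eq_fun do rewrite dquot_out//; exact: cvg_cst.
Qed.

Lemma norm_dright v p : `|v| <= 1 -> `|dright v p| <= L.
Proof.
move=> v1; have h : `|dquot v n p| @[n --> \oo] --> `|dright v p|.
  by apply: cvg_norm; exact: dquot_cvg.
rewrite -(cvg_lim _ h)//; apply: limr_le; first exact: cvgP h.
by apply: nearW => n; exact: norm_dquot.
Qed.

Lemma dright_ub v p : `|v| <= 1 -> 0 < U p ->
  exists2 t0 : R, 0 < t0 &
    forall t, 0 < t <= t0 -> U (p + t *: v) <= U p + t * dright v p.
Proof.
move=> v1 p0; have [l [h h1 _]] := concave_one_sided v1 p0.
by rewrite /dright (cvg_lim _ h).
Qed.

Lemma dright_lb v p (e : R) : `|v| <= 1 -> 0 < U p -> 0 < e ->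
  exists2 t0 : R, 0 < t0 &
    forall t, 0 < t <= t0 -> U p + t * (dright v p - e) <= U (p + t *: v).
Proof.
move=> v1 p0 e0; have [l [h _ h1]] := concave_one_sided v1 p0.
by rewrite /dright (cvg_lim _ h)//; exact: h1.
Qed.

Lemma concave_midpoint p v : 0 < U (p + v) -> 0 < U (p - v) ->
  U (p + v) + U (p - v) <= 2 * U p.
Proof.
move=> h1 h2; have := @Uconc (p + v) (p - v) (2^-1) _ h1 h2.
have -> : 1 - 2^-1 = 2^-1 :> R by field.
have -> : 2^-1 *: (p + v) + 2^-1 *: (p - v) = p.
  by apply: injective_projections; rewrite /= /GRing.scale/=; field.
by move=> h; have := h; rewrite invr_ge0 ler0n invf_le1// ler1n => /(_ isT); lra.
Qed.

Lemma Upos_near p : 0 < U p -> exists2 d : R, 0 < d &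
  forall v, `|v| <= d -> 0 < U (p + v).
Proof.
move=> p0; have L1 : 0 < L + 1 by rewrite ltr_wpDl.
exists (U p / (2 * (L + 1))); first by rewrite divr_gt0// mulr_gt0.
move=> v; rewrite ler_pdivlMr ?mulr_gt0// => vd.
by apply: lt_le_trans (Ulip' p v); have := normr_ge0 v; nra.
Qed.

(** If the sum were positive, [U (p + t *: v) + U (p - t *: v)] would exceed [2 * U p] for small
    [t], against midpoint concavity. *)
Lemma dright_sum_le0 v p : `|v| <= 1 -> dright v p + dright (- v) p <= 0.
Proof.
move=> v1; have Nv1 : `|- v| <= 1 by rewrite normrN.
have := U0 p; rewrite le_eqVlt => /predU1P[p0|p0].
  by rewrite !dright_out ?addr0.
rewrite leNgt; apply/negP => s0.
(* Losing [e] on each side still leaves half of the supposed positive sum. *)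
pose e := (dright v p + dright (- v) p) / 4.
have e0 : 0 < e by rewrite divr_gt0.
have [t1 t10 h1] := dright_lb v1 p0 e0.
have [t2 t20 h2] := dright_lb Nv1 p0 e0.
have [d d0 hd] := Upos_near p0.
pose t := Num.min t1 (Num.min t2 d).
have t0 : 0 < t by rewrite !lt_min t10 t20 d0.
have tv : `|t *: v| <= d.
  rewrite normrZ gtr0_norm//; apply: (@le_trans _ _ t); first exact: (ler_piMr (ltW t0)).
  by rewrite !ge_min lexx !orbT.
have := h1 t; rewrite t0 ge_min lexx => /(_ isT) h1t.
have := h2 t; rewrite t0 !ge_min lexx !orbT => /(_ isT) h2t.
rewrite scalerN in h2t.
have := concave_midpoint (hd _ tv) (hd (- (t *: v)) _); rewrite normrN => /(_ tv).
move: s0 e0 h1t h2t; rewrite /e => *; nra.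
Qed.

(** A concave function with two-sided partial derivatives is differentiable. The lower estimate at
    [p + v] holds because this point is the midpoint of [p + 2 v_1 e_1] and [p + 2 v_2 e_2], where
    the axis estimates apply. The upper estimate follows from the lower one at [p - v] by midpoint
    concavity. *)
Lemma dright_differentiable p : 0 < U p ->
  dright (basis2 0) p + dright (- basis2 0) p = 0 ->
  dright (basis2 1) p + dright (- basis2 1) p = 0 ->
  differentiable U p.
Proof.
move=> p0 s0 s1; have b1 := @norm_basis2 R; have bN1 := @norm_Nbasis2 R.
pose g : R * R := (dright (basis2 0) p, dright (basis2 1) p).
have Hax (e : R) i : 0 < e -> exists2 d : R, 0 < d & forall x : R, `|x| <= d ->
    U p + x * dright (basis2 i) p - e * `|x| <= U (p + x *: basis2 i).
  move=> e0; have sE : dright (- basis2 i) p = - dright (basis2 i) p.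
    apply/eqP; rewrite -addr_eq0 addrC; apply/eqP.
    by have [->|->] := ord2P i.
  have [d1 d10 h1] := dright_lb (b1 i) p0 e0.
  have [d2 d20 h2] := dright_lb (bN1 i) p0 e0.
  exists (Num.min d1 d2) => [|x]; first by rewrite lt_min d10.
  rewrite le_min => /andP[x1 x2]; have [x0|x0|->] := ltrgt0P x.
  - have := h1 x; rewrite x0 -(gtr0_norm x0) x1 (gtr0_norm x0) => /(_ isT).
    by apply: le_trans; lra.
  - have := h2 (- x); rewrite oppr_gt0 x0 -(ltr0_norm x0) x2 (ltr0_norm x0) => /(_ isT).
    by rewrite sE scalerN scaleNr opprK; apply: le_trans; lra.
  - by rewrite scale0r addr0; lra.
suff /differentiable_dot[] : forall e : R, 0 < e -> \forall v \near (0 : R * R),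
    `|U (v + p) - U p - dot g v| <= e * `|v| by [].
move=> e e0; have e2 : 0 < e / 4 by rewrite divr_gt0.
have [d1 d10 h1] := Hax _ 0 e2; have [d2 d20 h2] := Hax _ 1 e2.
have [d3 d30 h3] := Upos_near p0.
have lb v : `|v| <= d1 / 2 -> `|v| <= d2 / 2 -> `|v| <= d3 / 2 ->
    U p + dot g v - e * `|v| <= U (p + v).
  move=> v1 v2 v3; have [w1 w2] : `|v.1| <= `|v| /\ `|v.2| <= `|v|.
    by rewrite prod_normE/= !le_max !lexx orbT.
  have n2 (x : R) : `|2 * x| = 2 * `|x| by rewrite normrM ger0_norm.
  have k1 := h1 (2 * v.1); rewrite n2 in k1.
  have k2 := h2 (2 * v.2); rewrite n2 in k2.
  have l1 : 0 < U (p + (2 * v.1) *: basis2 0).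
    apply: h3; rewrite normrZ n2.
    by apply: le_trans (ler_piMr _ (b1 0)) _; [rewrite mulr_ge0|lra].
  have l2 : 0 < U (p + (2 * v.2) *: basis2 1).
    apply: h3; rewrite normrZ n2.
    by apply: le_trans (ler_piMr _ (b1 1)) _; [rewrite mulr_ge0|lra].
  have := @Uconc _ _ (2^-1) _ l1 l2.
  have -> : 2^-1 *: (p + (2 * v.1) *: basis2 0) + (1 - 2^-1) *: (p + (2 * v.2) *: basis2 1) = p + v.
    by apply: injective_projections; rewrite /= /basis2/= /GRing.scale/=; field.
  rewrite invr_ge0 ler0n invf_le1// ler1n => /(_ isT); apply: le_trans.
  have := k1 ltac:(lra); have := k2 ltac:(lra).
  have m1 : e * `|v.1| <= e * `|v| by rewrite ler_pM2l.
  have m2 : e * `|v.2| <= e * `|v| by rewrite ler_pM2l.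
  have m0 : 0 <= e * `|v| by rewrite mulr_ge0// ltW.
  rewrite /dot/g/=; lra.
apply/nbhs_ballP; exists (Num.min (d1 / 2) (Num.min (d2 / 2) (d3 / 2))) => /=.
  by rewrite !lt_min !divr_gt0.
move=> v; rewrite -ball_normE/= sub0r normrN !lt_min => /andP[/ltW v1 /andP[/ltW v2 /ltW v3]].
have := lb v v1 v2 v3; have := lb (- v); rewrite normrN => /(_ v1 v2 v3).
have := @concave_midpoint p v (h3 _ _) (h3 _ _); rewrite normrN.
move=> /(_ ltac:(lra) ltac:(lra)); rewrite [v + p]addrC => a1 a2 a3.
have : dot g (- v) = - dot g v by rewrite /dot/=; ring.
by move=> a4; rewrite ler_norml; apply/andP; split; lra.
Qed.

Lemma differentiable_dright v p : `|v| <= 1 -> 0 < U p -> differentiable U p ->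
  dright v p = 'D_v U p.
Proof.
move=> v1 p0 dU; rewrite derive_dot_grad//; apply/eqP; rewrite eq_le; apply/andP; split.
  apply/ler_addgt0Pr => e e0; rewrite -lerBlDr; apply: dot_grad_ge => //.
  exact: dright_lb.
exact/dot_grad_le/dright_ub.
Qed.

End one_sided_derivative.

(** * Integrals of directional derivatives *)

Section concave_bump_integrals.
Context {R : realType}.
Variables (U : R * R -> R) (L M : R).
Hypotheses (L0 : 0 <= L) (U0 : forall p, 0 <= U p)
  (Ulip : forall p v, U (p + v) <= U p + L * `|v|)
  (Uconc : forall p q (s : R), 0 <= s <= 1 -> 0 < U p -> 0 < U q ->
     s * U p + (1 - s) * U q <= U (s *: p + (1 - s) *: q))
  (Ubd : forall p, 0 < U p -> `|p| <= M).
Notation mR := (measurableTypeR R).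

Let N : set (mR * mR) := [set p | 0 < U p].

Lemma lip_continuous (h : R * R -> R) (C : R) : 0 <= C ->
  (forall p v, `|h (p + v) - h p| <= C * `|v|) -> continuous h.
Proof.
move=> C0 hC p; apply/cvgrPdist_le => e e0.
have C1 : 0 < C + 1 by rewrite ltr_wpDl.
near=> q; rewrite distrC -[q](subrKC p); apply: le_trans (hC _ _) _.
apply: (@le_trans _ _ ((C + 1) * `|q - p|)).
  by apply: ler_wpM2r => //; rewrite lerDl.
rewrite mulrC -ler_pdivlMr// distrC; near: q.
by apply: cvgr_dist_le => //; rewrite divr_gt0.
Unshelve. all: by end_near. Qed.

Lemma concave_bump_continuous : continuous U.
Proof.
apply: (lip_continuous L0) => p v; rewrite ler_norml; apply/andP; split.
  by have := Ulip (p + v) (- v); rewrite addrK normrN; lra.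
by have := Ulip p v; lra.
Qed.

Lemma measurable_support : measurable N.
Proof.
apply: open_measurable2.
rewrite (_ : N = U @^-1` [set x | 0 < x])//; apply: open_comp => //.
  by move=> p _; exact: concave_bump_continuous.
Qed.

Lemma leb2_support_lty : (leb2 N < +oo)%E.
Proof.
have NB : N `<=` `[- M, M]%classic `*` `[- M, M]%classic.
  move=> p /Ubd; rewrite prod_normE/= ge_max !ler_norml => /andP[h1 h2].
  by split; rewrite /= in_itv.
apply: (@le_lt_trans _ _ (leb2 (`[- M, M]%classic `*` `[- M, M]%classic))).
  apply: le_measure => //; rewrite inE; first exact: measurable_support.
  by apply: measurableX; exact: measurable_itv.
rewrite /leb2 product_measure1E; [|exact: measurable_itv..].
by rewrite /= !lebesgue_measure_itv/=; case: ifP => _; rewrite ?mule0 ?ltry// -EFinM ltry.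
Qed.

Lemma supported_integrable (h : mR * mR -> R) (C : R) :
  measurable_fun setT h -> (forall p, `|h p| <= C) ->
  (forall p, U p = 0 -> h p = 0) -> (@leb2 R).-integrable setT (EFin \o h).
Proof.
move=> mh hC h0; have -> : EFin \o h = (EFin \o h) \_ N.
  apply/funext => p; rewrite /patch; case: ifPn => // /negP pN /=.
  rewrite h0//; apply/eqP; rewrite eq_le U0 andbT leNgt; apply/negP => ?.
  by apply: pN; rewrite inE.
apply/(integrable_mkcond _ measurable_support).
apply: measurable_bounded_integrable.
- exact: measurable_support.
- exact: leb2_support_lty.
- exact: measurable_funTS.
exists C; split; first exact: num_real.
by move=> x Cx p _; exact: le_trans (hC p) (ltW Cx).
Qed.

Notation trunc := (trunc U L).
Notation dquot := (dquot U L).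
Notation dright := (dright U L).

Lemma measurable_trunc n : measurable_fun setT (trunc n : mR * mR -> R).
Proof.
apply: continuous_measurable2; apply: (lip_continuous L0) => p v.
exact: trunc_lip.
Qed.

Lemma measurable_trunc_shift n v :
  measurable_fun setT ((fun p => trunc n (p + v)) : mR * mR -> R).
Proof.
apply: continuous_measurable2; apply: (lip_continuous L0) => p w.
by rewrite [p + w + v]addrAC; exact: trunc_lip.
Qed.

Lemma trunc_ge0 n p : 0 <= trunc n p.
Proof. by rewrite /trunc le_max lexx orbT. Qed.

(** Compare with the point [(M + 1, 0)], which lies outside the support, by means of the Lipschitz
    bound. *)
Lemma concave_bump_le p : U p <= L * (2 * (`|M| + 1)).
Proof.
have M0 := normr_ge0 M; have MM := ler_norm M.
have := U0 p; rewrite le_eqVlt => /predU1P[<-|p0].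
  by rewrite mulr_ge0//; lra.
have : U ((M + 1, 0) : R * R) = 0.
  apply/eqP; rewrite eq_le U0 andbT leNgt; apply/negP => /Ubd.
  rewrite prod_normE/= ge_max => /andP[+ _]; rewrite ler_norml; lra.
have := Ulip (M + 1, 0) (p - (M + 1, 0)); rewrite subrKC => + U1; rewrite U1 add0r.
move/le_trans; apply; apply: ler_wpM2l => //; apply: le_trans (ler_normB _ _) _.
have := Ubd p0; have : `|(M + 1, 0) : R * R| <= `|M| + 1.
  rewrite prod_normE/= normr0 ge_max; apply/andP; split; last lra.
  by apply: le_trans (ler_normD _ _) _; rewrite normr1.
lra.
Qed.

Lemma integrable_trunc n : (@leb2 R).-integrable setT (EFin \o trunc n).
Proof.
apply: (@supported_integrable _ (L * (2 * (`|M| + 1)))).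
- exact: measurable_trunc.
- move=> p; rewrite ger0_norm ?trunc_ge0// /trunc ge_max.
  rewrite (le_trans (U0 p) (concave_bump_le p)) andbT; apply: le_trans (concave_bump_le p).
  by rewrite gerBl divr_ge0.
- move=> p p0; rewrite /trunc p0 (max_idPr _)// sub0r oppr_le0.
  by rewrite divr_ge0.
Qed.

Lemma integral_trunc_shift n v :
  (\int[leb2]_p (trunc n (p + v))%:E = \int[leb2]_p (trunc n p)%:E)%E.
Proof.
rewrite -(@ge0_integral_shift2 _ v (fun p => (trunc n p)%:E)).
- by [].
- by apply/measurable_EFinP; exact: measurable_trunc.
- by move=> p; rewrite lee_fin trunc_ge0.
Qed.

Lemma integrable_trunc_shift n v :
  (@leb2 R).-integrable setT (EFin \o (fun p => trunc n (p + v))).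
Proof.
apply/integrableP; split.
  by apply/measurable_EFinP; exact: measurable_trunc_shift.
have /integrableP[_] := integrable_trunc n.
under eq_integral do rewrite /= ger0_norm ?trunc_ge0//.
rewrite -(integral_trunc_shift n v) => h.
by under eq_integral do rewrite /= ger0_norm ?trunc_ge0//.
Qed.

(** The two truncations are translates of each other, so they have the same finite integral. *)
Lemma integral_dquot v n : `|v| <= 1 -> (\int[leb2]_p (dquot v n p)%:E = 0)%E.
Proof.
move=> v1; rewrite /dquot; under eq_integral do rewrite EFinM EFinB.
rewrite integralZl//; last first.
  by apply: integrableB => //; [exact: integrable_trunc_shift|exact: integrable_trunc].
rewrite integralB_EFin//; [|exact: integrable_trunc_shift|exact: integrable_trunc].
rewrite integral_trunc_shift subee ?mule0//.
exact: integrable_fin_num (integrable_trunc n).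
Qed.

Lemma measurable_dquot v n : measurable_fun setT (dquot v n : mR * mR -> R).
Proof.
apply: measurable_funM => //; apply: measurable_funB.
  exact: measurable_trunc_shift.
exact: measurable_trunc.
Qed.

Lemma measurable_dright v : `|v| <= 1 -> measurable_fun setT (dright v : mR * mR -> R).
Proof.
move=> v1; apply: (measurable_fun_cvg (measurable_dquot v)) => p _.
exact: dquot_cvg.
Qed.

Lemma integrable_dright v : `|v| <= 1 ->
  (@leb2 R).-integrable setT (EFin \o dright v).
Proof.
move=> v1; apply: (@supported_integrable _ L).
- exact: measurable_dright.
- by move=> p; exact: norm_dright.
- by move=> p p0; exact: dright_out.
Qed.

(** Dominated convergence applies to [dquot] with the dominating function [L] times the indicator of
    the support. *)
Lemma integral_dright v : `|v| <= 1 -> (\int[leb2]_p (dright v p)%:E = 0)%E.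
Proof.
move=> v1.
have ig : (@leb2 R).-integrable setT (EFin \o (fun p => L * \1_N p)).
  apply: (@supported_integrable _ L).
  - apply: measurable_funM => //; apply/measurable_indicP.
    exact: measurable_support.
  - move=> p; rewrite indicE normrM ger0_norm//; case: (p \in N);
      by rewrite ?normr1 ?normr0 ?mulr1 ?mulr0.
  - move=> p p0; have pN : ~ N p by rewrite /N/= p0 ltxx.
    by rewrite indicE memNset// mulr0.
have := @dominated_cvg _ _ _ (@leb2 R) setT measurableT
  (fun n p => (dquot v n p)%:E) (EFin \o dright v) _ _ _ _ ig.
have -> : (fun n => \int[leb2]_p (dquot v n p)%:E)%E = cst 0%E.
  by apply/funext => n; exact: integral_dquot.
move=> H; transitivity (limn (cst 0%E : nat -> \bar R)); last exact: lim_cst.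
symmetry; apply: cvg_lim => //; apply: H.
- by move=> n; apply/measurable_EFinP; exact: measurable_dquot.
- by move=> p _; apply: cvg_EFin; [exact: nearW|exact: dquot_cvg].
- by [].
- move=> n p _; rewrite /= lee_fin indicE.
  have [/set_mem pN|pN] := boolP (p \in N); first by rewrite mulr1 norm_dquot.
  rewrite mulr0 dquot_out ?normr0//.
  apply/eqP; rewrite eq_le U0 andbT leNgt; apply/negP => ?.
  by move/negP: pN; apply; rewrite inE.
Qed.

(** The jump of the [i]-th partial derivative: on the support it vanishes exactly where the two
    one-sided derivatives agree. *)
Definition kink i p := dright (basis2 i) p + dright (- basis2 i) p.

Lemma measurable_kink i : measurable_fun setT (kink i : mR * mR -> R).
Proof.
apply: measurable_funD; apply: measurable_dright.
  exact: norm_basis2.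
exact: norm_Nbasis2.
Qed.

Lemma measurable_kink_neq0 i : measurable ([set p | kink i p != 0] : set (mR * mR)).
Proof.
rewrite (_ : [set p | _] = setT `&` kink i @^-1` (~` [set 0])).
  by apply: measurable_kink => //; exact: measurableC.
by rewrite setTI; apply/seteqP; split => p /=; [move=> /eqP|move=> /eqP].
Qed.

(** The kink is nonpositive and has integral zero, so it vanishes almost everywhere. This is the
    source of almost everywhere differentiability. *)
Lemma kink_null i : leb2 [set p | kink i p != 0] = 0.
Proof.
have i0 : (\int[leb2]_p `|(kink i p)%:E| = 0)%E.
  under eq_integral => p _.
    rewrite /= ler0_norm; last by apply: dright_sum_le0 => //; exact: norm_basis2.
    rewrite opprD EFinB EFinN; over.
  rewrite integralB//=; last 2 first.
  - have := integrable_dright (norm_basis2 i); move/integrableN.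
    by apply: eq_integrable.
  - exact: (integrable_dright (norm_Nbasis2 i)).
  rewrite integral_dright ?norm_Nbasis2// sube0.
  under eq_integral do rewrite -mulN1r EFinM.
  rewrite integralZl//; last exact: (integrable_dright (norm_basis2 i)).
  by rewrite integral_dright ?norm_basis2// mule0.
have mk : measurable_fun setT (EFin \o kink i : mR * mR -> \bar R).
  by apply/measurable_EFinP; exact: measurable_kink.
have := (ae_eq_integral_abs (@leb2 R) measurableT mk).1 i0.
move=> ae; apply: measure_negligible; first exact: measurable_kink_neq0.
case: ae => A [mA A0 sA]; exists A; split => // p /= kp; apply: sA => /=.
by move=> /(_ Logic.I) [] /eqP; rewrite (negbTE kp).
Qed.

Definition diffset : set (mR * mR) := [set p | 0 < U p /\ differentiable U p].

(** Describing differentiability by the measurable functions [kink] makes the set of points of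
    differentiability measurable and of full measure in the support. *)
Lemma diffsetE : diffset =
  N `\` ([set p | kink 0 p != 0] `|` [set p | kink 1 p != 0]).
Proof.
apply/seteqP; split => p.
  move=> [p0 dU]; split => //.
  have k0 i : kink i p = 0.
    have dE v : `|v| <= 1 -> dright v p = 'D_v U p.
      by move=> v1; exact: differentiable_dright.
    rewrite /kink !dE ?norm_basis2 ?norm_Nbasis2//.
    by rewrite !derive_dot_grad// /dot/=; ring.
  by rewrite /= !k0 !eqxx => -[].
move=> [p0 /=]; rewrite not_orP => -[/negP/negPn/eqP k0 /negP/negPn/eqP k1].
by split => //; apply: dright_differentiable k0 k1.
Qed.

Lemma measurable_diffset : measurable diffset.
Proof.
rewrite diffsetE; apply: measurableD; first exact: measurable_support.
by apply: measurableU; exact: measurable_kink_neq0.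
Qed.

Lemma diffset_full : leb2 (N `\` diffset) = 0.
Proof.
apply/eqP; rewrite eq_le measure_ge0 andbT.
pose Z := [set p | kink 0 p != 0] `|` [set p | kink 1 p != 0].
have mZ : measurable (Z : set (mR * mR)).
  by apply: measurableU; exact: measurable_kink_neq0.
apply: (@le_trans _ _ (leb2 Z)).
  apply: le_measure; rewrite ?inE//.
    by apply: measurableD; [exact: measurable_support|exact: measurable_diffset].
  rewrite diffsetE => p [pN]; apply: contra_notP => nZ; by split.
apply: (@le_trans _ _ (leb2 [set p | kink 0%R p != 0%R]
                     + leb2 [set p | kink 1%R p != 0%R])%E).
  by apply: measureU2; exact: measurable_kink_neq0.
by rewrite !kink_null adde0.
Qed.

Lemma leb2_diffset : leb2 diffset = leb2 N.
Proof.
have sD : diffset `<=` N by move=> p [].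
rewrite -[in RHS](setDUK sD).
have mE : measurable (N `\` diffset).
  by apply: measurableD; [exact: measurable_support|exact: measurable_diffset].
have dis : diffset `&` (N `\` diffset) = set0.
  by apply/seteqP; split => p //= [] ? [].
transitivity (leb2 diffset + leb2 (N `\` diffset))%E.
  by rewrite [X in (_ + X)%E]diffset_full adde0.
by symmetry; apply: measureU => //; exact: measurable_diffset.
Qed.

(** The set left out consists of a null part of the support and of points where [dright] is 0, so
    the integral is that over the whole plane. *)
Lemma integral_diffset_dright v : `|v| <= 1 ->
  (\int[leb2]_(p in diffset) (dright v p)%:E = 0)%E.
Proof.
move=> v1.
have mE : measurable (N `\` diffset).
  by apply: measurableD; [exact: measurable_support|exact: measurable_diffset].
have := @negligible_integral _ _ _ (@leb2 R) setT (N `\` diffset) _ mE measurableT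
  (integrable_dright v1) diffset_full.
rewrite /= integral_dright// => ->.
rewrite [LHS]integral_mkcond [RHS]integral_mkcond; apply: eq_integral => p _.
rewrite /patch; have [/set_mem [p0 dU]|pD] := boolP (p \in diffset).
  by rewrite ifT// mem_set//; split=> // -[_]; apply.
case: ifPn => // /set_mem [_ /=] h.
rewrite dright_out//; apply/eqP; rewrite eq_le U0 andbT leNgt; apply/negP => p0.
by apply: h; split => // pD'; move/negP: pD; apply; rewrite inE.
Qed.

End concave_bump_integrals.

(** * Second order expansion *)

Section second_order.
Context {R : realType}.
Implicit Types (f : R * R -> R) (p v : R * R).

Lemma derive_along f v t : derivable f (t *: v) v ->
  is_derive (t : R) 1 (fun s : R => f (s *: v)) ('D_v f (t *: v)).
Proof.
have E : (fun h : R => h^-1 *: (((fun s : R => f (s *: v)) \o shift t) (h *: 1) - f (t *: v)))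
   = (fun h : R => h^-1 *: ((f \o shift (t *: v)) (h *: v) - f (t *: v))).
  by apply/funext => h; rewrite /= (_ : h%:A = h :> R) ?scalerDl//; exact: mulr1.
move=> df; split.
  by rewrite /derivable E.
by rewrite /derive E.
Qed.

Lemma grad_component_differentiable f p i : differentiable (grad f) p ->
  differentiable (fun q => 'D_(basis2 i) f q) p.
Proof.
move=> dG.
pose pr (w : R * R) := if i == 0 then w.1 else w.2.
have prE q : 'D_(basis2 i) f q = pr (grad f q).
  by rewrite /pr; have [->|->] := ord2P i.
have prD w w' : pr (w + w') = pr w + pr w' by rewrite /pr; case: ifP.
have prZ (a : R) w : pr (a *: w) = a * pr w by rewrite /pr; case: ifP.
have prN w : pr (- w) = - pr w by rewrite /pr; case: ifP.
have prle w : `|pr w| <= `|w|.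
  by rewrite /pr; case: ifP; rewrite prod_normE/= le_max lexx ?orbT.
pose g : R * R := (pr ('d (grad f) p (1, 0)), pr ('d (grad f) p (0, 1))).
have gE v : dot g v = pr ('d (grad f) p v).
  have {2}-> : v = v.1 *: (1, 0) + v.2 *: (0, 1) :> R * R.
    by apply: injective_projections; rewrite /= /GRing.scale/=; ring.
  by rewrite linearD !linearZ prD !prZ /dot/=; ring.
have [|//] := @differentiable_dot _ (fun q => 'D_(basis2 i) f q) p g.
move=> e e0; have /eqaddoP/(_ _ e0) := diff_locally dG.
apply: filterS => v /= h; rewrite !prE gE -!prN -!prD.
by apply: le_trans (prle _) _; rewrite -addrA -opprD; exact: h.
Qed.

(** Here [h0] and [h1] stand for the rows of the Hessian, [p] and [P] for the gradients at the
    origin and at [c *: v]. The right side collects the errors of linearising the gradient. *)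
Lemma dot_remainder (P p h0 h1 v : R * R) (c : R) :
  dot P v - (dot p v + c * (h0.1 * v.1 ^+ 2 + (h0.2 + h1.1) * (v.1 * v.2)
    + h1.2 * v.2 ^+ 2)) =
  (P.1 - p.1 - dot h0 (c *: v)) * v.1 + (P.2 - p.2 - dot h1 (c *: v)) * v.2.
Proof. by rewrite !linearZ /= /GRing.scale /dot /=; ring. Qed.

Lemma comb_le (x y a b m e : R) : `|x| <= e / 2 * m -> `|y| <= e / 2 * m ->
  `|a| <= m -> `|b| <= m -> x * a + y * b <= e * m ^+ 2.
Proof.
move=> xm ym am bm; apply: le_trans (ler_norm _) _; apply: le_trans (ler_normD _ _) _.
rewrite !normrM.
have := ler_pM (normr_ge0 _) (normr_ge0 _) xm am.
have := ler_pM (normr_ge0 _) (normr_ge0 _) ym bm.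
by rewrite expr2; lra.
Qed.

Lemma taylor_arith (X F D Q Z e : R) :
  X - (1 * D + 1 ^+ 2 * (2^-1 * Q)) - (F - (0 * D + 0 ^+ 2 * (2^-1 * Q))) = Z ->
  Z <= e -> X <= F + D + 2^-1 * Q + e.
Proof. by rewrite expr1n expr0n/=; lra. Qed.

(** Second derivatives are given at the origin alone. So the mean value theorem is applied to [f]
    minus its candidate expansion along the segment to [v], and the derivative of this difference is
    controlled by the first order expansion of the gradient. *)
Lemma second_order_upper f (eta : R) : twice_differentiable_at f (0, 0) -> 0 < eta ->
  exists2 rho : R, 0 < rho & forall v, `|v| <= rho ->
    f v <= f (0, 0) + dot (grad f (0, 0)) v
      + 2^-1 * (hessian f (0, 0) 0 0 * v.1 ^+ 2
        + (hessian f (0, 0) 0 1 + hessian f (0, 0) 1 0) * (v.1 * v.2)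
        + hessian f (0, 0) 1 1 * v.2 ^+ 2) + eta * `|v| ^+ 2.
Proof.
move=> [df dG] eta0; have e0 : 0 < eta / 2 by rewrite divr_gt0.
have n0 := grad_near (grad_component_differentiable 0 dG) e0.
have n1 := grad_near (grad_component_differentiable 1 dG) e0.
have df' : \forall v \near (0 : R * R), differentiable f v by exact: df.
have [d /= d0 hd] := (nbhs_ballP _ _).1 (filterI df' (filterI n0 n1)).
exists (d / 2) => [|v vd]; first by rewrite divr_gt0.
have H (t : R) : 0 <= t <= 1 -> [/\ differentiable f (t *: v),
    `|'D_(basis2 0) f (t *: v) - 'D_(basis2 0) f (0, 0)
       - dot (grad (fun q => 'D_(basis2 0) f q) (0, 0)) (t *: v)| <= eta / 2 * `|v| &
    `|'D_(basis2 1) f (t *: v) - 'D_(basis2 1) f (0, 0)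
       - dot (grad (fun q => 'D_(basis2 1) f q) (0, 0)) (t *: v)| <= eta / 2 * `|v|].
  move=> /andP[t0 t1]; have tv : `|t *: v| <= `|v|.
    by rewrite normrZ ger0_norm// ler_piMl.
  have /hd[h1 [h2 h3]] : ball (0 : R * R) d (t *: v).
    rewrite -ball_normE/= sub0r normrN; apply: le_lt_trans tv _.
    by apply: le_lt_trans vd _; rewrite ltr_pdivrMr// ltr_pMr// ltr1n.
  have z0 : t *: v + (0, 0) = t *: v by exact: addr0.
  rewrite z0 in h2 h3; split => //.
    by apply: le_trans h2 _; rewrite ler_pM2l.
  by apply: le_trans h3 _; rewrite ler_pM2l.
pose G := grad f (0, 0).
pose Q := hessian f (0, 0) 0 0 * v.1 ^+ 2
        + (hessian f (0, 0) 0 1 + hessian f (0, 0) 1 0) * (v.1 * v.2)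
        + hessian f (0, 0) 1 1 * v.2 ^+ 2.
pose phi (t : R) := f (t *: v) - (t * dot G v + t ^+ 2 * (2^-1 * Q)).
have dphi (t : R) : 0 <= t <= 1 ->
    is_derive t 1 phi ('D_v f (t *: v) - (dot G v + t * Q)).
  move=> /H[dft _ _]; have /derive_along h1 := diff_derivable (v := v) dft.
  apply: is_deriveB => //.
  have -> : dot G v + t * Q = 1 *: dot G v + (t * (1 + 1)) *: (2^-1 * Q).
    by rewrite /GRing.scale/=; field.
  apply: is_derive_eq.
  rewrite /GRing.scale/=; ring.
have [c] : exists2 c : R, c \in `]0, 1[ & phi 1 - phi 0 = ('D_v f (c *: v) - (dot G v + c * Q)) * (1 - 0).
  apply: (@MVT _ phi (fun c => 'D_v f (c *: v) - (dot G v + c * Q))) => //.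
    by move=> x /[!in_itv]/= /andP[x0 x1]; apply: dphi; rewrite !ltW.
  apply: derivable_within_continuous => x /[!in_itv]/= x01.
  by have [] := dphi x x01.
rewrite in_itv/= => /andP[c0 c1]; rewrite subr0 mulr1.
have [dc h0 h1] : _ := H c ltac:(by rewrite !ltW).
rewrite derive_dot_grad//.
have [w1 w2] : `|v.1| <= `|v| /\ `|v.2| <= `|v|.
  by rewrite prod_normE/= !le_max !lexx orbT.
rewrite /phi scale1r scale0r (_ : f 0 = f (0, 0))// => E.
have hE i j : hessian f (0, 0) i j = 'D_(basis2 j) (fun q => 'D_(basis2 i) f q) (0, 0).
  by rewrite mxE.
have : dot (grad f (c *: v)) v - (dot G v + c * Q) <= eta * `|v| ^+ 2.
  set x := 'D_(basis2 0) f (c *: v) - _ - _ in h0.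
  set y := 'D_(basis2 1) f (c *: v) - _ - _ in h1.
  have -> : dot (grad f (c *: v)) v - (dot G v + c * Q) = x * v.1 + y * v.2.
    rewrite /Q !hE.
    exact: (dot_remainder (grad f (c *: v)) G (grad (fun q => 'D_(basis2 0) f q) (0, 0))
      (grad (fun q => 'D_(basis2 1) f q) (0, 0)) v c).
  exact: comb_le h0 h1 w1 w2.
by rewrite -E; exact: taylor_arith (erefl _).
Qed.

(** Normalises the negative direction to [(s, 1)]. If [y] is nonzero, rescale; if [y = 0], then
    [a < 0] and a large [s] works. *)
Lemma negative_slope (x y a b c : R) : (x, y) != 0 ->
  a * x ^+ 2 + b * (x * y) + c * y ^+ 2 < 0 ->
  exists s : R, a * s ^+ 2 + b * s + c < 0.
Proof.
move=> xy; have [->|y0] := eqVneq y 0 => h.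
  have a0 : a < 0.
    have : 0 <= x ^+ 2 by exact: sqr_ge0.
    rewrite ltNge => x2; apply/negP => a0.
    by have := mulr_ge0 a0 x2; move: h; rewrite mulr0 expr0n/=; lra.
  (* Chosen so that [- a * s = - a + |b| + |c|], which beats the lower order terms because
     [s >= 1]. *)
  pose s := 1 + (`|b| + `|c|) / - a; have Na0 : 0 < - a by rewrite oppr_gt0.
  have s1 : 1 <= s by rewrite lerDl divr_ge0// ?addr_ge0// ltW.
  have sa : - a * s = - a + (`|b| + `|c|) by rewrite /s; field; rewrite lt_eqF.
  exists s; have := ler_norm b; have := ler_norm c; have := normr_ge0 c.
  move=> c0 cc bb; have -> : a * s ^+ 2 = - (- a * s) * s by ring.
  rewrite sa; nra.
exists (x / y); have y2 : 0 < y ^+ 2 by rewrite exprn_even_gt0.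
rewrite -(pmulr_llt0 _ y2); apply: le_lt_trans h; rewrite le_eqVlt; apply/orP; left.
by apply/eqP; field.
Qed.

(** On a left eigenvector [w] for the negative eigenvalue [b] the Hessian form equals
    [b * (w_1 ^ 2 + w_2 ^ 2)]. The Taylor error is then absorbed into the quadratic form without
    spoiling negativity. *)
Lemma quadratic_upper_bound f : twice_differentiable_at f (0, 0) ->
  indefinite (hessian f (0, 0)) ->
  exists (q0 q1 q2 a rho : R), [/\ q0 * a ^+ 2 + q1 * a + q2 < 0, 0 < rho &
    forall v, `|v| <= rho -> f v <= f (0, 0) + dot (grad f (0, 0)) v
      + (q0 * v.1 ^+ 2 + q1 * (v.1 * v.2) + q2 * v.2 ^+ 2)].
Proof.
move=> df [_ [b [_ b0 _ /eigenvalueP[w wH w0]]]].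
set H := hessian f (0, 0) in wH *.
have w01 j : w 0 0 * H 0 j + w 0 1 * H 1 j = b * w 0 j.
  have l1 : lift ord0 ord0 = 1 :> 'I_2 by exact: val_inj.
  have <- : (w *m H) 0 j = w 0 0 * H 0 j + w 0 1 * H 1 j.
    by rewrite mxE !big_ord_recl big_ord0 addr0 l1.
  by rewrite wH mxE.
have wn : (w 0 0, w 0 1) != 0.
  apply: contra_neq w0 => -[h0 h1]; apply/rowP => j; rewrite mxE.
  by have [->|->] := ord2P j.
have wneg : H 0 0 * w 0 0 ^+ 2 + (H 0 1 + H 1 0) * (w 0 0 * w 0 1) + H 1 1 * w 0 1 ^+ 2 < 0.
  have -> : H 0 0 * w 0 0 ^+ 2 + (H 0 1 + H 1 0) * (w 0 0 * w 0 1) + H 1 1 * w 0 1 ^+ 2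
     = (w 0 0 * H 0 0 + w 0 1 * H 1 0) * w 0 0 + (w 0 0 * H 0 1 + w 0 1 * H 1 1) * w 0 1 by ring.
  rewrite !w01 -!mulrA -mulrDr pmulr_llt0//.
  rewrite lt_neqAle addr_ge0 -?expr2 ?sqr_ge0// andbT eq_sym paddr_eq0 ?sqr_ge0// !sqrf_eq0.
  by apply: contra wn => /andP[/eqP-> /eqP->].
have [a aneg] := negative_slope wn wneg.
set P := H 0 0 * a ^+ 2 + (H 0 1 + H 1 0) * a + H 1 1 in aneg.
have a1 : 0 < a ^+ 2 + 1 by rewrite ltr_wpDl// sqr_ge0.
(* The perturbed form takes the value [P / 2 - P / 4 = P / 4 < 0] at [(a, 1)]. *)
pose eta := - P / (4 * (a ^+ 2 + 1)).
have eta0 : 0 < eta by rewrite divr_gt0 ?oppr_gt0// mulr_gt0.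
have [rho rho0 hrho] := second_order_upper df eta0.
exists (2^-1 * H 0 0 + eta), (2^-1 * (H 0 1 + H 1 0)), (2^-1 * H 1 1 + eta), a, rho; split => //.
  have -> : (2^-1 * H 0 0 + eta) * a ^+ 2 + 2^-1 * (H 0 1 + H 1 0) * a + (2^-1 * H 1 1 + eta)
     = 2^-1 * P + eta * (a ^+ 2 + 1) by rewrite /P; field.
  have -> : eta * (a ^+ 2 + 1) = - P / 4 by rewrite /eta; field; rewrite gt_eqF.
  lra.
move=> v /hrho /le_trans; apply; rewrite -/H -!addrA !lerD2l.
(* The norm on pairs is the maximum norm, dominated by the Euclidean one. *)
have : `|v| ^+ 2 <= v.1 ^+ 2 + v.2 ^+ 2.
  rewrite prod_normE/= /Num.max; case: ifP => _; rewrite real_normK ?num_real//.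
    by rewrite lerDr sqr_ge0.
  by rewrite lerDl sqr_ge0.
move=> /(ler_wpM2l (ltW eta0)); lra.
Qed.

End second_order.

(** * Convex sets and cone functions *)

Section convex_plane_sets.
Context {R : realType}.
Implicit Types (p q k v : R * R) (K : set (R * R)) (s t c : R).

Definition conv_closed K :=
  forall p q s, 0 <= s <= 1 -> K p -> K q -> K (s *: p + (1 - s) *: q).

Lemma convex_setE K : convex_set K <-> conv_closed K.
Proof.
split=> [cK p q s /andP[s0 s1] Kp Kq|cK p q l /set_mem Kp /set_mem Kq].
  by have /set_mem := cK p q (Itv01 s0 s1) (mem_set Kp) (mem_set Kq).
by apply/mem_set; apply: cK => //; apply/andP; split.
Qed.

Lemma conv_closed_comb K k1 k2 (a b : R) : conv_closed K -> K k1 -> K k2 ->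
  0 <= a -> 0 <= b -> exists2 k, K k & a *: k1 + b *: k2 = (a + b) *: k.
Proof.
move=> cK h1 h2 a0 b0; have [ab|ab] := eqVneq (a + b) 0.
  have [-> ->] : a = 0 /\ b = 0 by split; lra.
  by exists k1 => //; rewrite addr0 !scale0r addr0.
have ab0 : 0 < a + b by rewrite lt_neqAle eq_sym ab addr_ge0.
exists ((a / (a + b)) *: k1 + (1 - a / (a + b)) *: k2).
  by apply: cK => //; rewrite divr_ge0 ?addr_ge0//= ler_pdivrMr// mul1r lerDl.
by apply: injective_projections; rewrite /= /GRing.scale/=; field.
Qed.

Lemma closure_normP K p : closure K p <-> forall e, 0 < e -> exists2 q, K q & `|p - q| < e.
Proof.
split => [Kp e e0|H B /nbhs_ballP[e /= e0 eB]].
  by have [q [Kq]] := Kp _ (nbhsx_ballx p e e0); rewrite -ball_normE/=; exists q.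
have [q Kq pq] := H e e0; exists q; split => //; apply: eB.
by rewrite -ball_normE.
Qed.

Lemma interior_normP K p : interior K p <-> exists2 e, 0 < e & forall v, `|v| <= e -> K (p + v).
Proof.
split => [/nbhs_ballP[e /= e0 eK]|[e e0 eK]].
  exists (e / 2) => [|v ve]; first by rewrite divr_gt0.
  apply: eK; rewrite -ball_normE/= opprD addrA subrr sub0r normrN.
  by apply: le_lt_trans ve _; rewrite ltr_pdivrMr// ltr_pMr// ltr1n.
apply/nbhs_ballP; exists e => //= q; rewrite -ball_normE/= => pq.
by rewrite -[q](subrKC p); apply: eK; rewrite distrC ltW.
Qed.

Lemma conv_closed_closure K : conv_closed K -> conv_closed (closure K).
Proof.
move=> cK p q s s01 /closure_normP Kp /closure_normP Kq; apply/closure_normP => e e0.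
have e2 : 0 < e / 2 by rewrite divr_gt0.
have [p' Kp' pp'] := Kp _ e2; have [q' Kq' qq'] := Kq _ e2.
exists (s *: p' + (1 - s) *: q'); first exact: cK.
case/andP: s01 => s0 s1.
have -> : s *: p + (1 - s) *: q - (s *: p' + (1 - s) *: q')
    = s *: (p - p') + (1 - s) *: (q - q').
  by apply: injective_projections; rewrite /= /GRing.scale/=; ring.
apply: le_lt_trans (ler_normD _ _) _; rewrite !normrZ !ger0_norm ?subr_ge0//.
have := ler_wpM2l s0 (ltW pp'); have := @ler_wpM2l _ (1 - s) _ _ _ (ltW qq').
by rewrite subr_ge0 => /(_ s1); lra.
Qed.

(** Prolong the segment from the interior point [A] through [p] a little, and approximate its end by
    a point [q] of [K]. The ball around [A] absorbs the error, so [p] is a convex combination of two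
    points of [K]. *)
Lemma interior_closure_convex K : conv_closed K -> interior K !=set0 ->
  interior (closure K) = interior K.
Proof.
move=> cK [A /interior_normP[r r0 rK]]; apply/seteqP; split; last first.
  exact: (interiorS (@subset_closure _ K)).
suff sub : interior (closure K) `<=` K.
  move=> p /interior_normP[e e0 eK]; apply/interior_normP.
  exists (e / 2) => [|v ve]; first by rewrite divr_gt0.
  apply: sub; apply/interior_normP; exists (e / 2) => [|w we]; first by rewrite divr_gt0.
  rewrite -addrA; apply: eK; apply: le_trans (ler_normD _ _) _; lra.
move=> p /interior_normP[e e0 eK].
have c0 : 0 < `|p - A| + 1 by rewrite ltr_wpDl.
pose eta := e / (`|p - A| + 1); have eta0 : 0 < eta by rewrite divr_gt0.
have /closure_normP/(_ (eta * r)) [|q Kq pq] : closure K (p + eta *: (p - A)).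
- apply: eK; rewrite normrZ gtr0_norm// /eta mulrAC ler_pdivrMr// ler_pM2l//.
  by rewrite lerDl.
- exact: mulr_gt0.
(* This is the point near [A] for which [p] lies exactly on the segment to [q]. *)
have h1 : K (A + eta^-1 *: (p + eta *: (p - A) - q)).
  apply: rK; rewrite normrZ gtr0_norm ?invr_gt0// ler_pdivrMl//.
  by rewrite ltW.
have := @cK q (A + eta^-1 *: (p + eta *: (p - A) - q)) ((1 + eta)^-1) _ Kq h1.
have -> : (1 + eta)^-1 *: q + (1 - (1 + eta)^-1) *: (A + eta^-1 *: (p + eta *: (p - A) - q)) = p.
  apply: injective_projections; rewrite /= /GRing.scale/=; field;
    by rewrite !gt_eqF//; lra.
apply; rewrite invr_ge0 invf_le1; lra.
Qed.

End convex_plane_sets.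

(** * Cone functions over a convex set *)

Section cone_function.
Context {R : realType}.
Variables (K : set (R * R)) (A : R * R) (r : R).
Hypotheses (cK : conv_closed K) (r0 : 0 < r)
  (ballA : forall v, `|v| <= r -> K (A + v)).
Implicit Types (p q k v : R * R) (s t c : R).

(* The graph of [cone] is the cone with apex [(A, 1)] over [K]; off [K] the
   supremum is over the empty set, hence [0]. *)
Definition cone_set p : set R :=
  [set c | 0 <= c <= 1 /\ exists2 k, K k & p = c *: A + (1 - c) *: k].
Definition cone p : R := sup (cone_set p).

Let KA : K A.
Proof. by rewrite -[A]addr0; apply: ballA; rewrite normr0 ltW. Qed.

Lemma cone_setP p c : cone_set p c -> K p.
Proof. by move=> [c01 [k Kk ->]]; exact: cK. Qed.

Lemma cone_set0 p : K p -> cone_set p 0.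
Proof.
move=> Kp; split; first by rewrite lexx ler01.
by exists p => //; rewrite scale0r add0r subr0 scale1r.
Qed.

Lemma cone_set_sup p : K p -> has_sup (cone_set p).
Proof.
move=> Kp; split; first by exists 0; exact: cone_set0.
by exists 1 => c [/andP[]].
Qed.

Lemma cone_ub p c : cone_set p c -> c <= cone p.
Proof.
move=> pc; apply: ub_le_sup => //.
by have [_] := cone_set_sup (cone_setP pc).
Qed.

Lemma cone_out p : ~ K p -> cone p = 0.
Proof.
move=> nKp; rewrite /cone (_ : cone_set p = set0) ?sup0//.
by apply/seteqP; split => c // /cone_setP.
Qed.

Lemma cone_ge0 p : 0 <= cone p.
Proof.
by have [Kp|/cone_out->//] := pselect (K p); exact: cone_ub (cone_set0 Kp).
Qed.

Lemma cone_le1 p : cone p <= 1.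
Proof.
have [Kp|/cone_out->//] := pselect (K p).
by apply: ge_sup; [exists 0; exact: cone_set0|move=> c [/andP[]]].
Qed.

Lemma cone_gt0 p : 0 < cone p -> K p.
Proof. by apply: contraPP => /cone_out->; rewrite ltxx. Qed.

Lemma cone_le p (b : R) : 0 <= b -> (forall c, cone_set p c -> c <= b) -> cone p <= b.
Proof.
move=> b0 h; have [Kp|/cone_out->//] := pselect (K p).
by apply: ge_sup => //; exists 0; exact: cone_set0.
Qed.

(** Lowering the height by [d = |v| / r] frees a weight [d] for the point [A - d^-1 *: v], which
    lies in the ball around the apex and compensates the displacement [v]. *)
Lemma cone_lip p v : cone (p + v) <= cone p + r^-1 * `|v|.
Proof.
apply: cone_le => [|c pc]; first by rewrite addr_ge0 ?cone_ge0// mulr_ge0// invr_ge0 ltW.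
pose d := r^-1 * `|v|; have d0 : 0 <= d by rewrite mulr_ge0// invr_ge0 ltW.
rewrite -/d -lerBlDr; have [cd|cd] := leP c d.
  by apply: le_trans (cone_ge0 _); rewrite subr_le0.
apply: cone_ub; case: pc => /andP[c0 c1] [k Kk pE].
split; first by rewrite subr_ge0 ltW//=; lra.
have [v0|v0] := eqVneq v 0.
  by exists k => //; rewrite /d v0 normr0 mulr0 subr0 -pE v0 addr0.
have dn0 : d != 0 by rewrite mulf_neq0 ?invr_eq0 ?normr_eq0 ?gt_eqF.
have [||k' Kk' k'E] := conv_closed_comb (a := d) (b := 1 - c) cK _ Kk d0 _ (k1 := A - d^-1 *: v).
- apply: ballA; rewrite normrN normrZ ger0_norm ?invr_ge0// /d invfM invrK.
  by rewrite mulrAC -mulrA mulfV ?normr_eq0// mulr1.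
- by rewrite subr_ge0.
exists k' => //; have -> : 1 - (c - d) = d + (1 - c) by ring.
rewrite -k'E; move/eqP: pE; rewrite eq_sym -subr_eq => /eqP <-.
by apply: injective_projections; rewrite /= /GRing.scale/=; field.
Qed.

Lemma cone_concave p q s : 0 <= s <= 1 -> K p -> K q ->
  s * cone p + (1 - s) * cone q <= cone (s *: p + (1 - s) *: q).
Proof.
move=> /andP[s0 s1] Kp Kq; apply/ler_addgt0Pr => e e0.
have [c1 pc1 h1] := sup_adherent e0 (cone_set_sup Kp).
have [c2 pc2 h2] := sup_adherent e0 (cone_set_sup Kq).
have c12 : s * c1 + (1 - s) * c2 <= cone (s *: p + (1 - s) *: q).
  case: pc1 pc2 => /andP[c10 c11] [k1 Kk1 ->] [/andP[c20 c21] [k2 Kk2 ->]].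
  apply: cone_ub; split; first by apply/andP; split; nra.
  have [||k Kk kE] := conv_closed_comb (a := s * (1 - c1)) (b := (1 - s) * (1 - c2)) cK Kk1 Kk2.
  - by rewrite mulr_ge0// subr_ge0.
  - by rewrite mulr_ge0// subr_ge0.
  exists k => //; have -> : 1 - (s * c1 + (1 - s) * c2) = s * (1 - c1) + (1 - s) * (1 - c2) by ring.
  by rewrite -kE; apply: injective_projections; rewrite /= /GRing.scale/=; ring.
apply: (@le_trans _ _ (s * (c1 + e) + (1 - s) * (c2 + e))); last lra.
apply: lerD; apply: ler_wpM2l; rewrite ?subr_ge0// -lerBlDr ltW//.
Qed.

(** A positive weight [c] on the apex surrounds the point by a ball of radius [c * r]. Conversely,
    an interior point can be pushed away from [A] inside [K], which leaves a positive weight on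
    [A]. *)
Lemma cone_interior p : (0 < cone p) <-> interior K p.
Proof.
split=> [p0|/interior_normP[e e0 eK]].
  have [c [/andP[_ c1] [k Kk ->]] c0] := sup_adherent p0 (cone_set_sup (cone_gt0 p0)).
  rewrite subrr in c0; apply/interior_normP; exists (c * r) => [|v]; first exact: mulr_gt0.
  rewrite -ler_pdivrMl// => vr.
  have -> : c *: A + (1 - c) *: k + v = c *: (A + c^-1 *: v) + (1 - c) *: k.
    by apply: injective_projections; rewrite /= /GRing.scale/=; field; rewrite gt_eqF.
  apply: cK => //; first by rewrite ltW.
  by apply: ballA; rewrite normrZ gtr0_norm ?invr_gt0.
have c0 : 0 < `|p - A| + 1 by rewrite ltr_wpDl.
pose eta := e / (`|p - A| + 1); have eta0 : 0 < eta by rewrite divr_gt0.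
have e1 : 0 < 1 + eta by lra.
apply: (@lt_le_trans _ _ (eta / (1 + eta))); first exact: divr_gt0.
apply: cone_ub; split.
  by rewrite (divr_ge0 (ltW eta0) (ltW e1))/= ler_pdivrMr// mul1r; lra.
exists (p + eta *: (p - A)).
  apply: eK; rewrite normrZ gtr0_norm// /eta mulrAC ler_pdivrMr// ler_pM2l//.
  by rewrite lerDl.
by apply: injective_projections; rewrite /= /GRing.scale/=; field; rewrite gt_eqF.
Qed.

(** Homogeneity about the apex: the dilation of centre [A] and ratio [1 + e] multiplies [1 - cone]
    by at most [1 + e], since the same base point [k] can be used. *)
Lemma cone_away p (e : R) : 0 <= e -> K p ->
  (1 + e) * cone p - e <= cone (p + e *: (p - A)).
Proof.
move=> e0 Kp; have e1 : 0 < 1 + e by lra.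
rewrite lerBlDr -ler_pdivlMl//; apply: cone_le.
  by rewrite mulr_ge0 ?invr_ge0 ?(ltW e1)// addr_ge0 ?cone_ge0.
move=> c [/andP[c0 c1] [k Kk pE]]; rewrite ler_pdivlMl// -lerBlDr.
have [ce|ce] := leP ((1 + e) * c - e) 0.
  by apply: le_trans ce (cone_ge0 _).
apply: cone_ub; split.
  by apply/andP; split; [exact: ltW|nra].
by exists k => //; rewrite pE; apply: injective_projections; rewrite /= /GRing.scale/=; ring.
Qed.

(** At [c *: A + (1 - c) *: k] the affine function equals [c * h + (1 - c) * y k], which is at least
    [c * h]. *)
Lemma cone_le_affine (y : R * R -> R) p (h : R) : 0 < h -> y A = h ->
  (forall p q s, y (s *: p + (1 - s) *: q) = s * y p + (1 - s) * y q) ->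
  (forall k, K k -> 0 <= y k) -> K p -> cone p <= y p / h.
Proof.
move=> h0 yA yaff y0 Kp; apply: cone_le => [|c [/andP[c0 c1] [k Kk ->]]].
  by rewrite divr_ge0 ?y0// ltW.
rewrite yaff yA ler_pdivlMr// lerDl mulr_ge0 ?y0// subr_ge0//.
Qed.

Lemma cone_supergradient p q : 0 < cone p -> differentiable cone p -> K q ->
  cone q - cone p <= dot (grad cone p) (q - p).
Proof.
move=> p0 dp Kq; apply: dot_grad_ge => //; exists 1 => // s /andP[s0 s1].
have -> : p + s *: (q - p) = s *: q + (1 - s) *: p.
  by apply: injective_projections; rewrite /= /GRing.scale/=; ring.
apply: le_trans (cone_concave _ Kq (cone_gt0 p0)); first by lra.
by rewrite (ltW s0).
Qed.

(* The supergradient inequality together with homogeneity along the ray from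
   the apex: the affine function below is [1] at [A] and dominates [cone]. *)
Lemma cone_grad_ge0 p q : 0 < cone p -> differentiable cone p -> K q ->
  0 <= 1 + dot (grad cone p) (q - A).
Proof.
move=> p0 dp Kq; have h1 := cone_supergradient p0 dp Kq.
have h2 : cone p - 1 <= dot (grad cone p) (p - A).
  apply: dot_grad_ge => //; exists 1 => // s /andP[s0 s1].
  by apply: le_trans (cone_away (ltW s0) (cone_gt0 p0)); lra.
have -> : q - A = (q - p) + (p - A) by rewrite addrA subrK.
by rewrite linearD/=; have := cone_ge0 q; lra.
Qed.

End cone_function.

(** * Geometry near a nonsingular boundary point *)

Section supporting_geometry.
Context {R : realType}.
Implicit Types (Omega K : set (R * R)) (p q k v w d xi g : R * R) (s t a b c : R).

Lemma conv_closed3 K p q k a b : conv_closed K -> K p -> K q -> K k ->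
  0 <= a -> 0 <= b -> a + b <= 1 -> K (a *: p + b *: q + (1 - (a + b)) *: k).
Proof.
move=> cK Kp Kq Kk a0 b0 ab; have [m Km ->] := conv_closed_comb cK Kp Kq a0 b0.
by apply: cK => //; rewrite addr_ge0.
Qed.

(* Otherwise the line through [xi] directed by [c (w_2, - w_1) + delta d] is a
   second line of support. *)
Lemma nonsingular_tangent Omega xi w d c : conv_closed Omega ->
  boundary Omega xi -> ~ singular_point Omega xi ->
  (forall p, Omega p -> 0 <= dot w (p - xi)) -> 0 < dot w d ->
  closure Omega (xi + d) -> c != 0 ->
  forall delta, 0 < delta -> exists2 s1, 0 < s1 & forall s, 0 < s <= s1 ->
    closure Omega (xi + s *: (c *: (w.2, - w.1) + delta *: d)).
Proof.
move=> cO bxi nsing wO wd Kd c0 delta delta0.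
pose t : R * R := c *: (w.2, - w.1); pose e : R * R := (d.2, - d.1).
have wt : dot w t = 0 by rewrite /dot /t /= /GRing.scale/=; ring.
have et : dot e t = c * dot w d by rewrite /dot /e /t /= /GRing.scale/=; ring.
have ed : dot e d = 0 by rewrite /dot /e /=; ring.
(* Coordinates of [p - xi] in the basis [(t, d)]; [y] is nonnegative on [Omega]. *)
pose x p := dot e (p - xi) / (c * dot w d); pose y p := dot w (p - xi) / dot w d.
have cw : c * dot w d != 0 by rewrite mulf_neq0// gt_eqF.
have pE p : p = xi + x p *: t + y p *: d.
  have cw' : c * (w.1 * d.1 + w.2 * d.2) != 0 by exact: cw.
  have [c' w'] : c != 0 /\ w.1 * d.1 + w.2 * d.2 != 0 by move: cw'; rewrite mulf_eq0 negb_or => /andP[].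
  by rewrite /x /y /dot /e /t; apply: injective_projections; rewrite /= /GRing.scale/=; field;
    rewrite ?c' ?w'.
(* Without such a point, [delta * x - y] is nonpositive on [Omega], and its zero line through [xi]
   is a second line of support, with normal [v2]. *)
have [p [Op xp yp]] : exists p, [/\ Omega p, 0 < x p & y p < delta * x p].
  apply: contrapT => H; apply: nsing; split => //.
  pose v1 := - w; pose v2 := (delta / c) *: e - w.
  have v2t : dot v2 t = delta * dot w d.
    have -> : dot v2 t = (delta / c) * dot e t - dot w t.
      by rewrite /v2 /dot/= /GRing.scale/=; ring.
    by rewrite wt et subr0; field.
  exists [set p | dot v1 (p - xi) = 0], [set p | dot v2 (p - xi) = 0]; split.
  - exists v1; split => //.
      by apply: contraTneq wd => v10; rewrite -[w]opprK -/v1 v10 oppr0 /dot/= !mul0r addr0 ltxx.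
    move=> p /wO; rewrite /v1 /dot/=; lra.
  - exists v2; split => //.
      apply/eqP => v20; move: v2t; rewrite v20 /dot/= !mul0r addr0 => /esym/eqP.
      by rewrite mulf_eq0 !gt_eqF.
    move=> p Op.
    have -> : dot v2 (p - xi) = dot w d * (delta * x p - y p).
      rewrite /v2 /x /y; have -> : dot ((delta / c) *: e - w) (p - xi)
        = delta / c * dot e (p - xi) - dot w (p - xi).
        by rewrite /dot/= /GRing.scale/=; ring.
      by field; rewrite c0 gt_eqF.
    rewrite pmulr_rle0// subr_le0 leNgt; apply/negP => yp; apply: H; exists p; split => //.
    have y0 : 0 <= y p by rewrite divr_ge0 ?wO// ltW.
    by have := le_lt_trans y0 yp; rewrite pmulr_rgt0.
  - move=> /(congr1 (fun L : set (R * R) => L (xi + t))) /=.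
    rewrite [xi + t]addrC addrK v2t => E.
    have : dot v1 t = 0 by rewrite -[RHS]oppr0 -wt /v1 /dot/=; ring.
    by rewrite E => /eqP; rewrite mulf_eq0 !gt_eqF.
have cK := conv_closed_closure cO; have Kp := subset_closure Op.
have Kxi : closure Omega xi by case: bxi.
have y0 : 0 <= y p by rewrite divr_ge0 ?wO// ltW.
have D0 : 0 < (x p)^-1 + delta by rewrite addr_gt0// invr_gt0.
exists (((x p)^-1 + delta)^-1) => [|s /andP[s0 ss]]; first by rewrite invr_gt0.
have yx : 0 <= delta - y p / x p by rewrite subr_ge0 ler_pdivrMr// ltW.
(* The target is a convex combination of [p], [xi + d] and [xi]; the choice of the bound on [s]
   keeps the first two weights from exceeding 1 in total. *)
have := @conv_closed3 _ p (xi + d) xi (s / x p) (s * (delta - y p / x p)) cK Kp Kd Kxi.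
have -> : (s / x p) *: p + (s * (delta - y p / x p)) *: (xi + d)
   + (1 - (s / x p + s * (delta - y p / x p))) *: xi = xi + s *: (t + delta *: d).
  rewrite {2}(pE p); move: (y p) (x p) xp => yy xx xx0.
  by apply: injective_projections; rewrite /= /GRing.scale/=; field; rewrite gt_eqF.
apply; first by rewrite divr_ge0// ltW.
  by rewrite mulr_ge0// ltW.
have x'0 : 0 < (x p)^-1 by rewrite invr_gt0.
have E0 : 0 < (x p)^-1 + (delta - y p / x p) by exact: ltr_wpDr.
have E1 : (x p)^-1 + (delta - y p / x p) <= (x p)^-1 + delta.
  by rewrite addrA gerBl divr_ge0// ltW.
rewrite -mulrDr -ler_pdivlMr// mul1r; apply: le_trans ss _.
by rewrite lef_pV2 ?posrE.
Qed.

Lemma support_minimizer Omega w : bounded_set Omega -> Omega !=set0 ->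
  exists2 xi, closure Omega xi & forall p, closure Omega p -> 0 <= dot w (p - xi).
Proof.
move=> [M [_ OM]] [z Oz]; pose B := M + 1.
have OB : Omega `<=` `[- B, B]%classic `*` `[- B, B]%classic.
  move=> p Op; have : `|p| <= B by apply: OM => //; rewrite /B ltrDl.
  by rewrite prod_normE/= ge_max !ler_norml => /andP[? ?]; split; rewrite /= in_itv.
have cB : compact (`[- B, B]%classic `*` `[- B, B]%classic : set (R * R)).
  by apply: compact_setX; exact: segment_compact.
have clB : closed (`[- B, B]%classic `*` `[- B, B]%classic : set (R * R)).
  apply: compact_closed => //; exact: norm_hausdorff.
have cO : compact (closure Omega).
  apply: (subclosed_compact _ cB); first exact: closed_closure.
  by rewrite [X in _ `<=` X](closure_id _).1//; exact: closureS.
have [||xi] := compact_EVT_min (f := dot w) _ cO.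
- by exists z; exact: subset_closure.
- by apply: continuous_subspaceT => p; exact: dot_continuous.
move=> /set_mem Kxi H; exists xi => // p Kp.
by rewrite linearB/= subr_ge0; apply: H; exact: mem_set.
Qed.

Lemma dot_self_gt0 w : w != 0 -> 0 < dot w w.
Proof.
move=> w0; rewrite /dot -!expr2 lt_neqAle addr_ge0 ?sqr_ge0// andbT eq_sym.
rewrite paddr_eq0 ?sqr_ge0// !sqrf_eq0; apply: contra w0 => /andP[/eqP h1 /eqP h2].
by apply/eqP; apply: injective_projections.
Qed.

Lemma small_multiple w (e : R) : 0 < e -> exists2 b : R, 0 < b & `|(- b) *: w| <= e.
Proof.
move=> e0; have w1 : 0 < `|w| + 1 by rewrite ltr_wpDl.
exists (e / (`|w| + 1)); first exact: divr_gt0.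
rewrite normrZ normrN gtr0_norm ?divr_gt0// mulrAC ler_pdivrMr// ler_pM2l//.
by rewrite lerDl.
Qed.

Lemma dot_interior_gt0 K xi w p : w != 0 -> (forall q, K q -> 0 <= dot w (q - xi)) ->
  interior K p -> 0 < dot w (p - xi).
Proof.
move=> w0 wK /interior_normP[e e0 eK]; have [b b0 be] := small_multiple w e0.
have := wK _ (eK _ be).
have -> : dot w (p + - b *: w - xi) = dot w (p - xi) - b * dot w w.
  by rewrite /dot/= /GRing.scale/=; ring.
by rewrite subr_ge0; apply: lt_le_trans; rewrite mulr_gt0// dot_self_gt0.
Qed.

Lemma support_boundary Omega xi w : w != 0 -> closure Omega xi ->
  (forall p, closure Omega p -> 0 <= dot w (p - xi)) -> boundary Omega xi.
Proof.
move=> w0 Kxi wK; split => // ixi.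
have : 0 < dot w (xi - xi).
  by apply: (dot_interior_gt0 w0 wK); apply: interiorS ixi; exact: subset_closure.
by rewrite subrr /dot/= !mulr0 addr0 ltxx.
Qed.

(** The linear form [(a, 1)] attains its minimum and its maximum over the closure at two distinct
    boundary points, one of which is nonsingular; the sign [c] records which. The vector [d] leads
    from it to an interior point. *)
Lemma nonsingular_support Omega a : conv_closed Omega -> bounded_set Omega ->
  interior Omega !=set0 ->
  (forall xi eta, singular_point Omega xi -> singular_point Omega eta -> xi = eta) ->
  exists w xi d (r c : R), [/\ w = c *: (a, 1), c ^+ 2 = 1, closure Omega xi,
    forall p, closure Omega p -> 0 <= dot w (p - xi) &
    [/\ 0 < dot w d, 0 < r, forall v, `|v| <= r -> closure Omega (xi + d + v) &
    forall delta, 0 < delta -> exists2 s1, 0 < s1 & forall s, 0 < s <= s1 ->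
      closure Omega (xi + s *: ((1, - a) + delta *: d)) /\
      closure Omega (xi + s *: (- (1, - a) + delta *: d))]].
Proof.
move=> cO bO iO sing1.
have O0 : Omega !=set0 by case: iO => z /interior_subset; exists z.
have [z iz] := iO; have [r r0 rO] := (interior_normP _ _).1 iz.
pose w : R * R := (a, 1).
have w0 : w != 0 by apply/eqP => -[_ /eqP]; rewrite oner_eq0.
have Nw0 : - w != 0 by rewrite oppr_eq0.
have [xi1 K1 h1] := support_minimizer w bO O0.
have [xi2 K2 h2] := support_minimizer (- w) bO O0.
have b1 := support_boundary w0 K1 h1; have b2 := support_boundary Nw0 K2 h2.
have iK : interior (closure Omega) z by apply: interiorS iz; exact: subset_closure.
have p1 := dot_interior_gt0 w0 h1 iK; have p2 := dot_interior_gt0 Nw0 h2 iK.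
have [c [xi [c2 Kxi bxi hxi [pxi nxi]]]] : exists c xi, [/\ c ^+ 2 = 1, closure Omega xi,
    boundary Omega xi, forall p, closure Omega p -> 0 <= dot (c *: w) (p - xi) &
    0 < dot (c *: w) (z - xi) /\ ~ singular_point Omega xi].
  have [s1|s1] := pselect (singular_point Omega xi1); last first.
    by exists 1, xi1; rewrite scale1r expr1n.
  exists (-1), xi2; rewrite scaleN1r sqrrN expr1n; split => //; split => // s2.
  move: p2; rewrite -(sing1 _ _ s1 s2); move: p1; rewrite /dot/=; lra.
exists (c *: w), xi, (z - xi), r, c; split => //; split => //.
  by move=> v vr; rewrite subrKC; apply: subset_closure; exact: rO.
move=> delta delta0.
have c0 : c != 0 by apply: contra_eq_neq c2 => ->; rewrite expr0n/= eq_sym oner_eq0.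
have hO p : Omega p -> 0 <= dot (c *: w) (p - xi) by move=> ?; apply: hxi; exact: subset_closure.
have Kz : closure Omega (xi + (z - xi)).
  by rewrite subrKC; apply: subset_closure; exact: interior_subset.
have Nc0 : - c != 0 by rewrite oppr_eq0.
have [s1 s10 H1] := nonsingular_tangent cO bxi nxi hO pxi Kz c0 delta0.
have [s2 s20 H2] := nonsingular_tangent cO bxi nxi hO pxi Kz Nc0 delta0.
(* As [c ^ 2 = 1], the sign cancels, so the two uses of the tangent lemma give the directions
   [(1, - a)] and its opposite. *)
have E1 : c *: ((c *: w).2, - (c *: w).1) = (1, - a) :> R * R.
  apply: injective_projections; rewrite /= /GRing.scale/= ?mulr1 -?expr2 ?c2//.
  by rewrite mulrN mulrA -expr2 c2 mul1r.
have E2 : (- c) *: ((c *: w).2, - (c *: w).1) = - (1, - a) :> R * R.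
  by rewrite scaleNr E1.
exists (Num.min s1 s2) => [|s]; first by rewrite lt_min s10.
rewrite le_min => /andP[s0 /andP[ss1 ss2]]; rewrite -E2 -[in X in X /\ _]E1.
by split; [apply: H1|apply: H2]; rewrite s0.
Qed.

(** In the coordinates [x = dot g (1, - a)] and [y = dot g d] the coefficient of [y ^ 2] is a
    positive multiple of the value at [(a, 1)], hence negative. Half of this term absorbs the mixed
    term by completing the square. *)
Lemma quadratic_split (q0 q1 q2 a : R) d : q0 * a ^+ 2 + q1 * a + q2 < 0 ->
  a * d.1 + d.2 != 0 -> exists C c : R, [/\ 0 <= C, 0 < c & forall g,
    q0 * g.1 ^+ 2 + q1 * (g.1 * g.2) + q2 * g.2 ^+ 2
      <= C * dot g (1, - a) ^+ 2 - c * dot g d ^+ 2].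
Proof.
set P := (X in X < 0); set k := (X in X != 0) => P0 k0.
have k2 : 0 < k ^+ 2 by rewrite exprn_even_gt0.
(* The coefficients of [y ^ 2], [x * y] and, below, [x ^ 2] after the change of coordinates. *)
pose al := P / k ^+ 2; pose be := (2 * q0 * a + q1) / k - 2 * P * d.1 / k ^+ 2.
pose ga := P * d.1 ^+ 2 / k ^+ 2 - (2 * q0 * a + q1) * d.1 / k + q0.
have al0 : al < 0 by rewrite pmulr_llt0 ?invr_gt0.
exists (`|ga| + be ^+ 2 / (- al * 2)), (- al / 2); split.
- by rewrite addr_ge0// divr_ge0 ?sqr_ge0//; lra.
- lra.
move=> g; set x := dot g (1, - a); set y := dot g d.
have g2E : g.2 = (y - d.1 * x) / k.
  by rewrite /y /x /dot/= /k; move: k0; rewrite /k => k0; field.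
have g1E : g.1 = x + a * ((y - d.1 * x) / k) by rewrite -g2E /x /dot/=; ring.
have -> : q0 * g.1 ^+ 2 + q1 * (g.1 * g.2) + q2 * g.2 ^+ 2 = al * y ^+ 2 + be * (y * x) + ga * x ^+ 2.
  by rewrite g1E g2E /al /be /ga /P; field.
have gx : ga * x ^+ 2 <= `|ga| * x ^+ 2 by apply: ler_wpM2r; rewrite ?sqr_ge0// ler_norm.
have : 0 <= (- al * y - be * x) ^+ 2 / (- al * 2) by rewrite divr_ge0 ?sqr_ge0//; lra.
have -> : (- al * y - be * x) ^+ 2 / (- al * 2)
   = - al / 2 * y ^+ 2 - be * (y * x) + be ^+ 2 / (- al * 2) * x ^+ 2.
  by field; rewrite lt_eqF.
rewrite mulrDl; lra.
Qed.

(** * Gradient of the cone function with apex near the support point *)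

Section cone_at_support.
Variables (K : set (R * R)) (w xi d : R * R) (a r h : R).
Hypotheses (cK : conv_closed K) (Kxi : K xi)
  (wK : forall p, K p -> 0 <= dot w (p - xi)) (wt : dot w (1, - a) = 0)
  (wd : 0 < dot w d) (r0 : 0 < r) (ballK : forall v, `|v| <= r -> K (xi + d + v))
  (h0 : 0 < h) (h1 : h <= 1).

Notation T := ((1, - a) : R * R).
Notation A := (xi + h *: d).
Notation u := (cone K A).

(** The homothety of centre [xi] and ratio [h] carries the ball around [xi + d] to the ball around
    [A]. *)
Lemma apex_ball v : `|v| <= h * r -> K (A + v).
Proof.
move=> vr; have -> : A + v = h *: (xi + d + h^-1 *: v) + (1 - h) *: xi.
  by apply: injective_projections; rewrite /= /GRing.scale/=; field; rewrite gt_eqF.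
apply: cK => //; first by rewrite ltW.
by apply: ballK; rewrite normrZ gtr0_norm ?invr_gt0// ler_pdivrMl.
Qed.

Let hr0 : 0 < h * r. Proof. exact: mulr_gt0. Qed.

(** Testing [cone_grad_ge0] at the two points of [K] on either side of [xi] gives
    [s0 * |x| <= 1 + s0 * delta0 * |y|] for the tangential part [x] and the part [y] along [d].
    Squaring uses [(1 + m) ^ 2 <= 2 + 2 * m ^ 2]. *)
Lemma tangential_grad_le (s0 delta0 : R) p : 0 < s0 -> 0 < delta0 -> h <= s0 * delta0 ->
  K (xi + s0 *: (T + delta0 *: d)) -> K (xi + s0 *: (- T + delta0 *: d)) ->
  0 < u p -> differentiable u p ->
  dot (grad u p) T ^+ 2 <= 2 / s0 ^+ 2 + 2 * delta0 ^+ 2 * dot (grad u p) d ^+ 2.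
Proof.
move=> s00 d00 hs K1 K2 p0 dp.
have := cone_grad_ge0 cK hr0 apex_ball p0 dp K1.
have := cone_grad_ge0 cK hr0 apex_ball p0 dp K2.
move: (grad u p) => g.
have -> : dot g (xi + s0 *: (- T + delta0 *: d) - A)
   = - (s0 * dot g T) + (s0 * delta0 - h) * dot g d.
  by rewrite /dot/= /GRing.scale/=; ring.
have -> : dot g (xi + s0 *: (T + delta0 *: d) - A)
   = s0 * dot g T + (s0 * delta0 - h) * dot g d.
  by rewrite /dot/= /GRing.scale/=; ring.
move: (dot g T) (dot g d) => x y k1 k2.
have yy : (s0 * delta0 - h) * y <= s0 * delta0 * `|y|.
  apply: le_trans (ler_norm _) _; rewrite normrM; apply: ler_wpM2r => //.
  by rewrite ger0_norm ?subr_ge0// gerBl ltW.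
have xx : `|s0 * x| <= 1 + s0 * delta0 * `|y| by rewrite ler_norml; apply/andP; split; lra.
have x2 : (s0 * x) ^+ 2 <= (1 + s0 * delta0 * `|y|) ^+ 2.
  by rewrite -[leLHS]real_normK ?num_real// lerXn2r// nnegrE// addr_ge0// !mulr_ge0// ltW.
have s2 : 0 < s0 ^+ 2 by rewrite exprn_gt0.
rewrite -(ler_pM2l s2); have -> : s0 ^+ 2 * (2 / s0 ^+ 2 + 2 * delta0 ^+ 2 * y ^+ 2)
  = 2 + 2 * (s0 * delta0 * `|y|) ^+ 2.
  by rewrite [(_ * `|y|) ^+ 2]exprMn real_normK ?num_real//; field; rewrite gt_eqF.
rewrite -exprMn; apply: le_trans x2 _; move: (s0 * delta0 * `|y|) => m.
have := sqr_ge0 (1 - m); rewrite !expr2; lra.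
Qed.

(** Affine domination gives [u p <= y / h], while [u] is at least [1 - x / s] at the point [z]
    reached from [p] by adding [(h - y) *: d]. The rise exceeds [1 - 1/4 - 1/2 = 1/4] over a
    parameter length less than [h]. *)
Lemma normal_grad_ge (s x y : R) : K (xi + s *: T + h *: d) -> 0 < s ->
  0 < x < s / 4 -> h / 4 < y < h / 2 ->
  let p := xi + x *: T + y *: d in
  0 < u p /\ (differentiable u p -> (4 * h)^-1 <= dot (grad u p) d).
Proof.
move=> Kq s00 /andP[x0 xs] /andP[y1 y2] p.
pose l := x / s; have l0 : 0 < l by rewrite divr_gt0.
have l4 : l < 1 / 4 by rewrite /l ltr_pdivrMr//; lra.
have ls : l * s = x by rewrite /l divfK// gt_eqF.
have yh1 : 1 / 4 < y / h by rewrite ltr_pdivlMr//; lra.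
have yh2 : y / h < 1 / 2 by rewrite ltr_pdivrMr//; lra.
have yhh : y / h * h = y by rewrite divfK// gt_eqF.
have up : 0 < u p.
  (* Here [p] is the combination of [A], [xi + s *: T + h *: d] and [xi] with weights [al], [l] and
     [1 - y / h]. *)
  pose al := y / h - l.
  have al0 : 0 < al by rewrite /al; lra.
  apply: (lt_le_trans al0); apply: (cone_ub cK hr0 apex_ball).
  split; first by rewrite /al; apply/andP; split; lra.
  have [||k Kk kE] := conv_closed_comb (a := l) (b := 1 - y / h) cK Kq Kxi; [lra|lra|].
  exists k => //; have -> : 1 - al = l + (1 - y / h) by rewrite /al; ring.
  rewrite -kE /al /p -ls -[in LHS]yhh.
  by apply: injective_projections; rewrite /= /GRing.scale/=; ring.
split=> // dp.
have ule : u p <= y / h.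
  have := @cone_le_affine _ K A (h * r) cK hr0 apex_ball (fun q => dot w (q - xi) / dot w d) p h h0.
  have -> : dot w (p - xi) / dot w d = y.
    have -> : dot w (p - xi) = x * dot w T + y * dot w d.
      by rewrite /p /dot/= /GRing.scale/=; ring.
    by rewrite wt mulr0 add0r mulfK// gt_eqF.
  apply.
  - by rewrite [xi + _]addrC addrK linearZ/= mulfK// gt_eqF.
  - move=> q1 q2 b.
    have -> : dot w (b *: q1 + (1 - b) *: q2 - xi) = b * dot w (q1 - xi) + (1 - b) * dot w (q2 - xi).
      by rewrite /dot/= /GRing.scale/=; ring.
    by ring.
  - by move=> k Kk; rewrite divr_ge0 ?wK// ltW.
  - exact: (cone_gt0 cK hr0 apex_ball up).
pose z := xi + x *: T + h *: d.
have zE : z = (1 - l) *: A + (1 - (1 - l)) *: (xi + s *: T + h *: d).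
  by rewrite /z -ls; apply: injective_projections; rewrite /= /GRing.scale/=; ring.
have zl : cone_set K A z (1 - l).
  by split; [apply/andP; split; lra|exists (xi + s *: T + h *: d)].
have uz := cone_ub cK hr0 apex_ball zl.
have Kz := cone_setP cK hr0 apex_ball zl.
have := cone_supergradient cK hr0 apex_ball up dp Kz.
have -> : z - p = (h - y) *: d.
  by rewrite /z /p; apply: injective_projections; rewrite /= /GRing.scale/=; ring.
rewrite linearZ/=; move: (dot (grad u p) d) => m; rewrite /GRing.scale/= => hm.
have m1 : 1 / 4 <= (h - y) * m by lra.
have m0 : 0 < m by nra.
by rewrite -[_^-1]mul1r ler_pdivrMr; nra.
Qed.

End cone_at_support.
End supporting_geometry.

(** * Estimates of the functional *)

Section strip_area.
Context {R : realType}.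
Notation mR := (measurableTypeR R).
Implicit Types (w xi : R * R).

Definition strip w xi (x1 x2 y1 y2 : R) : set (mR * mR) :=
  [set p | x1 < p.1 < x2 /\ y1 < dot w ((p : R * R) - xi) < y2].

Lemma measurable_strip w xi (x1 x2 y1 y2 : R) : measurable (strip w xi x1 x2 y1 y2).
Proof.
have -> : strip w xi x1 x2 y1 y2 = (fst @^-1` `]x1, x2[%classic) `&`
    ((fun p : R * R => dot w (p - xi)) @^-1` `]y1, y2[%classic).
  by apply/seteqP; split => p /=; rewrite !in_itv.
apply: open_measurable2; apply: openI; apply: open_comp => //.
- by move=> p _; exact: cvg_fst.
- have -> : (fun p : R * R => dot w (p - xi)) = dot w \- cst (dot w xi).
    by apply/funext => p; rewrite linearB.
  by move=> p _; apply: cvgB; [exact: dot_continuous|exact: cvg_cst].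
Qed.

(** Each nonempty vertical section is an interval of length [y2 - y1] because [w.2] is 1 or -1; the
    sign decides its orientation. *)
Lemma leb2_strip w xi (x1 x2 y1 y2 : R) : w.2 ^+ 2 = 1 -> x1 < x2 -> y1 < y2 ->
  leb2 (strip w xi x1 x2 y1 y2) = ((x2 - x1) * (y2 - y1))%:E.
Proof.
move=> w2 x12 y12.
transitivity (\int[@lebesgue_measure R]_(x in `]x1, x2[) (y2 - y1)%:E)%E; last first.
  rewrite integral_cst//= lebesgue_measure_itv/= lte_fin x12 -EFinB -EFinM.
  by rewrite mulrC.
rewrite /leb2 /product_measure1 [RHS]integral_mkcond; apply: eq_integral => x _ /=.
rewrite /patch; case: ifPn => [/set_mem|/negP xx]; last first.
  rewrite (_ : xsection _ x = set0) ?measure0//.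
  apply/seteqP; split => // y; rewrite /xsection/= => /set_mem[/= x0 _].
  by apply: xx; rewrite inE/= in_itv.
rewrite /= in_itv/= => xx; pose b := w.1 * (x - xi.1) - w.2 * xi.2.
have dE y : dot w ((x, y) - xi) = b + w.2 * y by rewrite /dot/b/=; ring.
have sE : xsection (strip w xi x1 x2 y1 y2) x = [set y | y1 < b + w.2 * y < y2].
  apply/seteqP; split => y; rewrite /xsection/=; first by move=> /set_mem[_]; rewrite dE.
  by move=> h; apply/mem_set; split => //=; rewrite dE.
rewrite sE; have /eqP := w2; rewrite sqrf_eq1 => /orP[|] /eqP ->.
  rewrite (_ : [set y | _] = `]y1 - b, y2 - b[%classic).
    by rewrite lebesgue_measure_itv/= lte_fin ltrD2r y12 -EFinB; congr EFin; ring.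
  by apply/seteqP; split => y /=; rewrite in_itv/= => /andP[? ?]; apply/andP; split; lra.
rewrite (_ : [set y | _] = `]b - y2, b - y1[%classic).
  by rewrite lebesgue_measure_itv/= lte_fin ltrD2l ltrN2 y12 -EFinB; congr EFin; ring.
by apply/seteqP; split => y /=; rewrite in_itv/= => /andP[? ?]; apply/andP; split; lra.
Qed.

End strip_area.

Section functional_estimates.
Context {R : realType}.
Notation mR := (measurableTypeR R).
Implicit Types (Omega : set (R * R)) (f U : R * R -> R) (p v : R * R).

Lemma functional0 Omega f :
  functional Omega f (fun=> 0) = f (0, 0) * fine (leb2 (interior Omega)).
Proof.
have g0 p : grad (fun=> 0 : R) p = (0, 0) by rewrite /grad !derive_cst.
have dE : diff_points Omega (fun=> 0 : R) = interior Omega.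
  apply/seteqP; split => p; first by case.
  by move=> ip; split => //; exact: differentiable_cst.
rewrite /functional dE; under eq_Rintegral do rewrite g0.
by rewrite Rintegral_cst//; apply: open_measurable2; exact: open_interior.
Qed.

Lemma derive_lip U (L : R) p v : (forall p v, `|U (p + v) - U p| <= L * `|v|) ->
  derivable U p v -> `|'D_v U p| <= L * `|v|.
Proof.
move=> UL dU.
have L0 : 0 <= L * `|v| by apply: le_trans (UL p v).
have cv : `|t^-1 *: ((U \o shift p) (t *: v) - U p)| @[t --> (0 : R)^'] --> `|'D_v U p|.
  by apply: cvg_norm; exact: dU.
rewrite -(cvg_lim _ cv)//; apply: limr_le; first exact: cvgP cv.
apply: nearW => t /=; rewrite normrZ normfV [t *: v + p]addrC.
have [->|t0] := eqVneq t 0; first by rewrite normr0 invr0 mul0r.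
rewrite ler_pdivrMl ?normr_gt0//; apply: le_trans (UL p _) _.
by rewrite normrZ mulrCA.
Qed.

(** Intended for [g0] and [g1] the partial derivatives: the first order term drops out as their
    integrals vanish. What remains is the constant cost [k0] and the gain [k1] on [Z]. *)
Lemma Rintegral_upper_bound (D Z : set (mR * mR)) (F g0 g1 : mR * mR -> R)
    (a l0 l1 k0 k1 : R) :
  measurable D -> (leb2 D < +oo)%E -> measurable Z -> Z `<=` D ->
  (@leb2 R).-integrable D (EFin \o F) ->
  (@leb2 R).-integrable D (EFin \o g0) -> (@leb2 R).-integrable D (EFin \o g1) ->
  \int[leb2]_(p in D) g0 p = 0 -> \int[leb2]_(p in D) g1 p = 0 ->
  (forall p, D p -> F p <= a + (l0 * g0 p + l1 * g1 p) + (k0 - k1 * \1_Z p)) ->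
  \int[leb2]_(p in D) F p <= (a + k0) * fine (leb2 D) - k1 * fine (leb2 Z).
Proof.
move=> mD Dfin mZ ZD iF i0 i1 z0 z1 Fle.
have icst (b : R) : (@leb2 R).-integrable D (EFin \o cst b).
  apply: measurable_bounded_integrable => //.
  by exists `|b|; split; [exact: num_real|move=> y /ltW by_ p _].
have iZ : (@leb2 R).-integrable D (EFin \o (\1_Z : mR * mR -> R)).
  apply: measurable_bounded_integrable => //.
  exists 1; split; first exact: num_real.
  move=> y /ltW y1 p _; apply: le_trans y1; rewrite indicE.
  by case: (p \in Z); rewrite ?normr1 ?normr0.
have iM (b : R) (h : mR * mR -> R) : (@leb2 R).-integrable D (EFin \o h) ->
    (@leb2 R).-integrable D (EFin \o (fun p => b * h p)).
  move=> ih; have := integrableZl mD b ih.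
  by apply: eq_integrable => // p _.
have iA (h k : mR * mR -> R) : (@leb2 R).-integrable D (EFin \o h) ->
    (@leb2 R).-integrable D (EFin \o k) ->
    (@leb2 R).-integrable D (EFin \o (fun p => h p + k p)).
  move=> ih ik; have := integrableD mD ih ik.
  by apply: eq_integrable => // p _.
have h0 := iM l0 g0 i0; have h1 := iM l1 g1 i1; have hZ := iM (- k1) \1_Z iZ.
have h1Z := iA _ _ h1 hZ; have h01Z := iA _ _ h0 h1Z.
pose G p := (a + k0) + (l0 * g0 p + (l1 * g1 p + (- k1) * \1_Z p)).
have iG : (@leb2 R).-integrable D (EFin \o G) by apply: (iA _ _ (icst _)).
apply: (@le_trans _ _ (\int[leb2]_(p in D) G p)).
  by apply: le_Rintegral => // p /Fle/le_trans; apply; rewrite /G; lra.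
rewrite /G (RintegralD mD (icst _) h01Z) (RintegralD mD h0 h1Z) (RintegralD mD h1 hZ).
rewrite !RintegralZl// z0 z1 !mulr0 !add0r Rintegral_cst// mulNr.
rewrite /Rintegral integral_indic// (_ : Z `&` D = Z)//.
by apply/seteqP; split => p; [case|move=> Zp; split => //; exact: ZD].
Qed.

End functional_estimates.

Lemma norm_pair_le {R : realType} (v : R * R) (c : R) :
  `|v.1| <= c -> `|v.2| <= c -> `|v| <= c.
Proof. by rewrite prod_normE/= ge_max => -> ->. Qed.

(** * The competitor: a multiple of the cone function *)

Section scaled_cone.
Context {R : realType}.
Notation mR := (measurableTypeR R).
Variables (Omega : set (R * R)) (A : R * R) (r eps : R).
Hypotheses (cO : conv_closed Omega) (bO : bounded_set Omega)
  (iO : interior Omega !=set0) (r0 : 0 < r) (eps0 : 0 < eps)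
  (ballA : forall v, `|v| <= r -> closure Omega (A + v)).

Let K := closure Omega.
Definition scaled_cone p := eps * cone K A p.
Notation U := scaled_cone.
Notation L := (eps / r).

Let cK : conv_closed K. Proof. exact: conv_closed_closure. Qed.
Let L0 : 0 <= L. Proof. by rewrite divr_ge0// ltW. Qed.

Lemma scaled_cone_ge0 p : 0 <= U p.
Proof. by rewrite mulr_ge0 ?(cone_ge0 cK r0 ballA)// ltW. Qed.

Lemma scaled_cone_lip p v : U (p + v) <= U p + L * `|v|.
Proof.
by rewrite -mulrA -mulrDr ler_pM2l//; exact: (cone_lip cK r0 ballA).
Qed.

Lemma scaled_cone_abs_lip p v : `|U (p + v) - U p| <= L * `|v|.
Proof.
have := scaled_cone_lip p v; have := scaled_cone_lip (p + v) (- v).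
by rewrite addrK normrN => h1 h2; rewrite ler_norml; apply/andP; split; lra.
Qed.

Lemma scaled_cone_gt0 p : (0 < U p) = (0 < cone K A p).
Proof. by rewrite pmulr_rgt0. Qed.

Lemma scaled_cone_concave p q (s : R) : 0 <= s <= 1 -> K p -> K q ->
  s * U p + (1 - s) * U q <= U (s *: p + (1 - s) *: q).
Proof.
move=> s01 Kp Kq; have := cone_concave cK r0 ballA s01 Kp Kq.
by rewrite -(ler_pM2l eps0) mulrDr ![eps * (_ * _)]mulrCA.
Qed.

Let Uconc p q (s : R) : 0 <= s <= 1 -> 0 < U p -> 0 < U q ->
  s * U p + (1 - s) * U q <= U (s *: p + (1 - s) *: q).
Proof.
rewrite !scaled_cone_gt0 => s01 p0 q0; apply: scaled_cone_concave => //.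
  exact: (cone_gt0 cK r0 ballA p0).
exact: (cone_gt0 cK r0 ballA q0).
Qed.

(** The cone function is positive exactly on the interior of the closure, which for a convex set
    with interior points is the interior itself. *)
Lemma scaled_cone_support : [set p | 0 < U p] = interior Omega.
Proof.
rewrite -(interior_closure_convex cO iO); apply/seteqP; split => p /=.
  by rewrite scaled_cone_gt0 => /(cone_interior cK r0 ballA).
by move=> /(cone_interior cK r0 ballA); rewrite scaled_cone_gt0.
Qed.

Let Ubd : exists M : R, forall p, 0 < U p -> `|p| <= M.
Proof.
have [M [_ OM]] := bO; exists (M + 1) => p p0.
have : interior Omega p by rewrite -scaled_cone_support.
by move=> /interior_subset Op; apply: (OM (M + 1)) => //; rewrite ltrDl.
Qed.

Lemma diff_points_scaled_cone : diff_points Omega U = diffset U.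
Proof. by rewrite /diff_points -scaled_cone_support. Qed.

Lemma scaled_cone_admissible : U_ Omega U.
Proof.
split.
- apply: continuous_subspaceT; exact: (concave_bump_continuous L0 scaled_cone_lip).
- move=> t p q /set_mem Kp /set_mem Kq.
  have := @scaled_cone_concave p q t%:inum _ Kp Kq.
  have t01 : 0 <= t%:inum <= 1 by apply/andP; split.
  move=> /(_ t01) h; rewrite -[leRHS]/(t%:inum * - U p + (1 - t%:inum) * - U q).
  by rewrite -[X in - U X <= _]/(t%:inum *: p + (1 - t%:inum) *: q); lra.
- exists L; split; first exact: num_real.
  move=> M LM p [_ dU] /=; apply: le_trans (ltW LM).
  have b i : `|'D_(basis2 i) U p| <= L.
    apply: le_trans (derive_lip scaled_cone_abs_lip _) _.
      exact: diff_derivable.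
    by apply: ler_piMr => //; exact: norm_basis2.
  by apply: norm_pair_le; [exact: (b 0)|exact: (b 1)].
- move=> p [_ np]; apply/eqP; rewrite eq_le scaled_cone_ge0 andbT leNgt.
  by apply/negP => p0; apply: np; rewrite -scaled_cone_support.
Qed.

Lemma scaled_cone_C1norm : (C1norm Omega U <= (eps + L + L)%:E)%E.
Proof.
have b i : (ereal_sup [set `|'D_(basis2 i) U p|%:E | p in partial_points Omega U i] <= L%:E)%E.
  apply: ge_ereal_sup => _ [p [_ dU] <-]; rewrite lee_fin.
  apply: le_trans (derive_lip scaled_cone_abs_lip dU) _.
  by apply: ler_piMr => //; exact: norm_basis2.
rewrite /C1norm !EFinD; apply: leeD; last exact: b.
apply: leeD; last exact: b.
apply: ge_ereal_sup => _ [p _ <-]; rewrite lee_fin ger0_norm ?scaled_cone_ge0//.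
by rewrite /U ler_piMr ?(ltW eps0)//; exact: (cone_le1 cK r0 ballA).
Qed.

Lemma scaled_cone_grad p : differentiable U p ->
  differentiable (cone K A) p /\ grad U p = eps *: grad (cone K A) p.
Proof.
move=> dU; have uE : cone K A = eps^-1 *: (U : R * R -> R^o).
  by apply/funext => q; rewrite fctE /U /GRing.scale/= mulKf// gt_eqF.
have du : differentiable (cone K A) p by rewrite uE; exact: differentiableZ.
split => //; have UE : U = eps *: (cone K A : R * R -> R^o) by [].
have D i : 'D_(basis2 i) U p = eps * 'D_(basis2 i) (cone K A) p.
  by rewrite UE deriveZ//; exact: diff_derivable.
by apply: injective_projections; rewrite /= D.
Qed.

(** The partial derivatives are replaced by the globally measurable [dright], with which they agree
    on [D], and [Z] by its intersection with [D], which differs from it by a null set. *)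
Lemma functional_scaled_cone_le (f : R * R -> R) (B a l0 l1 k0 k1 : R) (Z : set (mR * mR)) :
  continuous f -> (forall v, `|v| <= L -> `|f v| <= B) ->
  measurable Z -> Z `<=` interior Omega ->
  (forall p, 0 < U p -> differentiable U p -> f (grad U p) <=
    a + (l0 * 'D_(basis2 0) U p + l1 * 'D_(basis2 1) U p) + (k0 - k1 * \1_Z p)) ->
  functional Omega f U <= (a + k0) * fine (leb2 (interior Omega)) - k1 * fine (leb2 Z).
Proof.
move=> cf fB mZ ZN fle; have [M UM] := Ubd.
pose D := diffset U; pose N : set (mR * mR) := [set p | 0 < U p].
have mD : measurable D := measurable_diffset L0 scaled_cone_ge0 scaled_cone_lip Uconc.
have mN : measurable N := measurable_support L0 scaled_cone_lip.
have ND0 : leb2 (N `\` D) = 0 := diffset_full L0 scaled_cone_ge0 scaled_cone_lip Uconc UM.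
have DN : leb2 D = leb2 N := leb2_diffset L0 scaled_cone_ge0 scaled_cone_lip Uconc UM.
have Dfin : (leb2 D < +oo)%E by rewrite DN; exact: (leb2_support_lty L0 scaled_cone_lip UM).
pose g i := dright U L (basis2 i).
have b1 i : `|basis2 i| <= 1 :> R by exact: norm_basis2.
have gE i p : D p -> g i p = 'D_(basis2 i) U p.
  move=> [p0 dU]; exact: (differentiable_dright L0 scaled_cone_lip Uconc).
have gL i p : `|g i p| <= L by apply: norm_dright => //;
    first [exact: scaled_cone_ge0|exact: scaled_cone_lip|exact: Uconc].
have mg i : measurable_fun setT (g i : mR * mR -> R) by apply: measurable_dright => //;
    first [exact: scaled_cone_ge0|exact: scaled_cone_lip|exact: Uconc].
have ig i : (@leb2 R).-integrable D (EFin \o g i).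
  apply: (integrableS measurableT mD) => //.
  exact: (integrable_dright L0 scaled_cone_ge0 scaled_cone_lip Uconc UM).
have zg i : \int[leb2]_(p in D) g i p = 0.
  by rewrite /Rintegral (integral_diffset_dright L0 scaled_cone_ge0 scaled_cone_lip Uconc UM).
have fE : functional Omega f U = \int[leb2]_(p in D) f (g 0 p, g 1 p).
  rewrite /functional diff_points_scaled_cone; apply: eq_Rintegral => p /set_mem Dp.
  by rewrite /grad -!gE.
pose Z' := Z `&` D.
have mZ' : measurable Z' by exact: measurableI.
have -> : leb2 Z = leb2 Z'.
  have mE : measurable (Z `\` D) by exact: measurableD.
  have E0 : leb2 (Z `\` D) = 0.
    apply/eqP; rewrite eq_le measure_ge0 andbT -ND0; apply: le_measure; rewrite ?inE//.
      exact: measurableD.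
    by move=> p [Zp nD]; split => //; move: (ZN _ Zp); rewrite -scaled_cone_support.
  transitivity (leb2 Z' + leb2 (Z `\` D))%E.
    rewrite -[in LHS](setUIDK Z D); apply: measureU => //.
    by apply/seteqP; split => p //= [] [_ ?] [].
  by rewrite [X in (_ + X)%E]E0 adde0.
rewrite -scaled_cone_support -/N -DN fE.
apply: (@Rintegral_upper_bound _ D Z' _ (g 0) (g 1) a l0 l1 k0 k1) => //.
- by move=> p [].
- apply: measurable_bounded_integrable => //.
    apply: measurable_funTS.
    apply: (@measurableT_comp _ _ _ _ _ _ (f : mR * mR -> R)).
      exact: continuous_measurable2.
    by apply: measurable_fun_pair; exact: mg.
  exists B; split; first exact: num_real.
  move=> y /ltW By p _; apply: le_trans By; apply: fB.
  by apply: norm_pair_le; exact: gL.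
- move=> p Dp; have [p0 dU] := Dp; have := fle p p0 dU.
  rewrite /grad -!gE//; have -> : \1_Z p = \1_Z' p :> R.
    by rewrite !indicE /Z' in_setI (mem_set Dp) andbT.
  by [].
Qed.

End scaled_cone.

(** * Elementary estimates for the choice of parameters *)

Lemma small_parameter {R : realType} (c b : R) : 0 < c -> 0 <= b ->
  exists2 x : R, 0 < x & x <= 1 /\ b * x <= c.
Proof.
move=> c0 b0; have b1 : 0 < b + 1 by lra.
exists (Num.min 1 (c / (b + 1))); first by rewrite lt_min ltr01 divr_gt0.
split; first by rewrite ge_min lexx.
apply: (@le_trans _ _ ((b + 1) * (c / (b + 1)))).
  apply: ler_pM => //; rewrite ?lerDl//; last by rewrite ge_min lexx orbT.
  by rewrite le_min ler01/= divr_ge0// ltW.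
by rewrite mulrC divfK// gt_eqF.
Qed.

Lemma continuous_bounded_near {R : realType} (f : R * R -> R) p : {for p, continuous f} ->
  exists2 e : R, 0 < e & forall v, `|v - p| <= e -> `|f v| <= `|f p| + 1.
Proof.
move=> /cvgrPdist_le/(_ _ ltr01)/nbhs_ballP[e /= e0 fe].
exists (e / 2) => [|v ve]; first by rewrite divr_gt0.
have : `|f p - f v| <= 1.
  apply: fe; rewrite -ball_normE/= distrC; apply: le_lt_trans ve _.
  by rewrite ltr_pdivrMr// ltr_pMr// ltr1n.
have := ler_normB (f p) (f p - f v); rewrite subKr; lra.
Qed.

Lemma strip_arith {R : realType} (s x z m : R) : x + s / 16 < z -> z < x + 3 * s / 16 ->
  `|m| <= s / 16 -> 0 < z - x - m < s / 4.
Proof. by move=> h1 h2; rewrite ler_norml => /andP[h3 h4]; apply/andP; split; lra. Qed.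

(** The gain is inversely proportional to [delta], whereas the cost [kV] does not depend on it. *)
Lemma energy_arith {R : realType} (kV E delta : R) : 0 <= kV -> 0 < E -> 0 < delta ->
  delta <= E / (32 * (64 * (kV + 1))) -> kV - E / (32 * 32 * delta) < 0.
Proof.
move=> kV0 E0 d0; rewrite ler_pdivlMr; last by rewrite !mulr_gt0// ltr_wpDl.
move=> hd; rewrite subr_lt0 ltr_pdivlMr ?mulr_gt0//.
have := mulr_ge0 kV0 (ltW d0); lra.
Qed.

(** Smallness of [delta0] makes the part of the tangential energy proportional to [y] consume at
    most half of the gain [e * y]. *)
Lemma grad_energy_le {R : realType} (C e delta0 s0 x y : R) : 0 <= C -> 0 < delta0 -> delta0 <= 1 ->
  C * delta0 <= e / 4 -> x <= 2 / s0 ^+ 2 + 2 * delta0 ^+ 2 * y -> 0 <= y ->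
  C * x - e * y <= 2 * C / s0 ^+ 2 - e / 2 * y.
Proof.
move=> C0 d0 d1 Cd xy y0; have := ler_wpM2l C0 xy.
have : C * delta0 ^+ 2 <= e / 4.
  by apply: le_trans Cd; apply: ler_wpM2l => //; rewrite expr2 ler_piMr// ltW.
move=> /(ler_wpM2r y0); rewrite mulrDr; lra.
Qed.

Theorem corollary1 (R : realType) (Omega : set (R * R)) (f : R * R -> R)
    (Omega_convex : convex_set Omega)
    (Omega_bounded : bounded_set Omega)
    (Omega_interior : interior Omega !=set0)
    (f_continuous : continuous f)
    (f_twice_diff : twice_differentiable_at f (0, 0))
    (f_indefinite : indefinite (hessian f (0, 0)))
    (at_most_one_singular : forall xi eta : R * R,
       singular_point Omega xi -> singular_point Omega eta -> xi = eta) :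
  ~ zero_is_local_min Omega f.
Proof.
move=> [rad rad0 Hmin].
have cO := (convex_setE Omega).1 Omega_convex.
pose K := closure Omega; have cK : conv_closed K := conv_closed_closure cO.
have [q0 [q1 [q2 [a [rho [qneg rho0 fq]]]]]] := quadratic_upper_bound f_twice_diff f_indefinite.
have [w [xi [d [r [c [wE c2 Kxi wK [wd r0 ballK tang]]]]]]] :=
  nonsingular_support a cO Omega_bounded Omega_interior at_most_one_singular.
have wd' : dot w d = c * (a * d.1 + d.2) by rewrite wE /dot/= /GRing.scale/=; ring.
have ad : a * d.1 + d.2 != 0.
  by apply: contraTneq wd => ad0; rewrite wd' ad0 mulr0 ltxx.
have wt : dot w (1, - a) = 0 by rewrite wE /dot/= /GRing.scale/=; ring.
have c0 : c != 0 by apply: contra_eq_neq c2 => ->; rewrite expr0n/= eq_sym oner_eq0.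
have [C [e [C0 e0 qsplit]]] := quadratic_split qneg ad.
have [delta0 d00 [d01 d0C]] := small_parameter (divr_gt0 e0 (ltr0n _ 4)) C0.
have [s0 s00 tang0] := tang _ d00.
pose kap := dot w d.
pose V := fine (leb2 (interior Omega)).
have V0 : 0 <= V by exact: fine_ge0.
(* The cost density of the tangential gradient. It is fixed by [delta0] and [s0], before the apex
   height is chosen. *)
pose k := 2 * C / s0 ^+ 2.
have k0 : 0 <= k by rewrite divr_ge0 ?sqr_ge0// mulr_ge0.
have kV1 : 0 < e * kap / (32 * (64 * (k * V + 1))).
  by rewrite divr_gt0 ?mulr_gt0// ltr_wpDl// mulr_ge0.
have d1' : 0 < 1 / (8 * (`|d.1| + 1)) by rewrite divr_gt0// mulr_gt0// ltr_wpDl.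
(* [delta] is the slope of the flat piece of the boundary seen at scale [s];
   the apex is put at height [s * delta]. *)
pose delta := Num.min (e * kap / (32 * (64 * (k * V + 1)))) (1 / (8 * (`|d.1| + 1))).
have delta_gt0 : 0 < delta by rewrite lt_min kV1.
have [s1 s10 tang1] := tang _ delta_gt0.
(* The three bounds put the tangent points at scale [s] into [K], give [h <= s0 * delta0], and give
   [h <= 1]. *)
pose s := Num.min s1 (Num.min (s0 * delta0 / delta) (1 / delta)).
have s_gt0 : 0 < s by rewrite !lt_min s10 !divr_gt0// mulr_gt0.
pose h := s * delta; have h0 : 0 < h by rewrite mulr_gt0.
have hs0 : h <= s0 * delta0.
  by rewrite /h -ler_pdivlMr// !ge_min lexx !orbT.
have h1 : h <= 1 by rewrite /h -ler_pdivlMr// !ge_min lexx !orbT.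
have [K1 _] : K (xi + s *: ((1, - a) + delta *: d)) /\ K (xi + s *: (- (1, - a) + delta *: d)).
  by apply: tang1; rewrite s_gt0 ge_min lexx.
have [K2 K3] : K (xi + s0 *: ((1, - a) + delta0 *: d)) /\ K (xi + s0 *: (- (1, - a) + delta0 *: d)).
  by apply: tang0; rewrite s00 lexx.
have K1' : K (xi + s *: (1, - a) + h *: d) by rewrite -addrA /h -scalerA -scalerDr.
pose A := xi + h *: d; pose u := cone K A.
have hr0 : 0 < h * r by rewrite mulr_gt0.
have ballA v : `|v| <= h * r -> K (A + v) by exact: (apex_ball cK Kxi ballK h0 h1).
(* For [p = xi + x *: (1, - a) + y *: d] one has [dot w (p - xi) = y * kap] and
   [p.1 - xi.1 = x + y * d.1]. Since [|y * d.1| <= s / 16] on this strip, the margins force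
   [0 < x < s / 4], as [normal_grad_ge] requires. *)
pose Z := strip w xi (xi.1 + s / 16) (xi.1 + 3 * s / 16) (kap * (h / 4)) (kap * (h / 2)).
have mZ : measurable Z by exact: measurable_strip.
have ZE : leb2 Z = (s / 8 * (kap * h / 4))%:E.
  rewrite leb2_strip.
  - by congr EFin; field.
  - by rewrite wE /= /GRing.scale/= mulr1.
  - lra.
  - by rewrite ltr_pM2l//; lra.
have deltad : delta * `|d.1| <= 1 / 8.
  have : delta <= 1 / (8 * (`|d.1| + 1)) by rewrite ge_min lexx orbT.
  rewrite ler_pdivlMr ?mulr_gt0 ?ltr_wpDl// => h2; move: (`|d.1|) h2 => n; lra.
have Zu p : Z p -> 0 < u p /\ (differentiable u p -> (4 * h)^-1 <= dot (grad u p) d).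
  move=> [/andP[p1 p2] /andP[y1 y2]].
  pose y := dot w (p - xi) / kap; pose x := p.1 - xi.1 - y * d.1.
  have yk : y * kap = dot w (p - xi) by rewrite /y divfK// gt_eqF.
  have hy1 : h / 4 < y by rewrite -(ltr_pM2r wd) -/kap yk mulrC.
  have hy2 : y < h / 2 by rewrite -(ltr_pM2r wd) -/kap yk mulrC.
  have pE : p = xi + x *: (1, - a) + y *: d.
    have yk' : y * (a * d.1 + d.2) = a * (p.1 - xi.1) + (p.2 - xi.2).
      apply: (mulfI c0); rewrite mulrCA -wd' yk wE /dot/= /GRing.scale/=; ring.
    apply: injective_projections; rewrite /= /GRing.scale/= /x; first by ring.
    have -> : p.2 = xi.2 + (y * (a * d.1 + d.2) - a * (p.1 - xi.1)) by rewrite yk'; ring.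
    by ring.
  have yd : `|y * d.1| <= s / 16.
    have -> : s / 16 = s * (1 / 8) / 2 by field.
    rewrite normrM gtr0_norm; last by lra.
    apply: (@le_trans _ _ (h / 2 * `|d.1|)); first by apply: ler_wpM2r => //; exact: ltW.
    rewrite /h; have := ler_wpM2l (ltW s_gt0) deltad; lra.
  rewrite {}pE; apply: (@normal_grad_ge _ K w xi d a r h cK Kxi wK wt wd r0 ballK h0 h1 s) => //.
    exact: strip_arith.
  by rewrite hy1.
have [rho1 rho10 Mb] := continuous_bounded_near (f_continuous (0, 0)).
pose b := (h * r)^-1.
have b0 : 0 < b by rewrite invr_gt0.
(* Since [eps * b] bounds the partial derivatives, the three bounds keep the gradient where the
   quadratic bound on [f] holds, keep [f (grad U)] bounded for integrability, and keep the norm of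
   [U] below [rad]. *)
pose eps := Num.min (rho / b) (Num.min (rho1 / b) (rad / (2 * (1 + 2 * b)))).
have b2 : 0 < 1 + 2 * b by lra.
have eps0 : 0 < eps by rewrite !lt_min !divr_gt0// mulr_gt0.
have eps1 : eps * b <= rho by rewrite -ler_pdivlMr// ge_min lexx.
have eps2 : eps * b <= rho1 by rewrite -ler_pdivlMr// !ge_min lexx !orbT.
have eps3 : eps * (1 + 2 * b) < rad.
  have : eps <= rad / (2 * (1 + 2 * b)) by rewrite !ge_min lexx !orbT.
  rewrite ler_pdivlMr ?mulr_gt0//; lra.
pose U := scaled_cone Omega A eps.
have Uadm : U_ Omega U by exact: (scaled_cone_admissible cO Omega_interior hr0 eps0 ballA).
have UC : (C1norm Omega U < rad%:E)%E.
  apply: le_lt_trans (scaled_cone_C1norm cO hr0 eps0 ballA) _.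
  by rewrite lte_fin -/b; lra.
have := Hmin U Uadm UC; apply/negP; rewrite -ltNge functional0 -/V.
(* The quadratic part scales by [eps ^ 2]. Everywhere it costs at most [k], and on [Z] the slope of
   at least [1 / (4 * h)] along [d] yields the gain. *)
have Upt p : 0 < U p -> differentiable U p -> f (grad U p) <=
    f (0, 0) + dot (grad f (0, 0)) (grad U p)
      + (eps ^+ 2 * k - eps ^+ 2 * (e / 2 / (4 * h) ^+ 2) * \1_Z p).
  rewrite scaled_cone_gt0// => up dU.
  have [du gU] := scaled_cone_grad eps0 dU.
  have bi i : `|'D_(basis2 i) U p| <= rho.
    apply: le_trans (derive_lip (scaled_cone_abs_lip cO hr0 eps0 ballA) _) _.
      exact: diff_derivable.
    by apply: le_trans eps1; apply: ler_piMr; rewrite ?norm_basis2// mulr_ge0// ltW.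
  apply: le_trans (fq _ _) _; first by apply: norm_pair_le; [exact: (bi 0)|exact: (bi 1)].
  rewrite lerD2l gU.
  have tg := tangential_grad_le cK Kxi r0 ballK h0 h1 s00 d00 hs0 K2 K3 up du.
  have zg : (4 * h)^-2 * \1_Z p <= dot (grad u p) d ^+ 2.
    rewrite indicE; have [/set_mem/Zu[_ /(_ du) gd]|_] := boolP (p \in Z); last by rewrite mulr0 sqr_ge0.
    rewrite mulr1 -exprVn lerXn2r ?nnegrE//; first by rewrite invr_ge0 mulr_ge0// ltW.
    by apply: le_trans gd; rewrite invr_ge0 mulr_ge0// ltW.
  have := grad_energy_le C0 d00 d01 d0C tg (sqr_ge0 _).
  have := qsplit (grad u p).
  move: (dot (grad u p) (1, - a)) (dot (grad u p) d) zg => X Y zg.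
  move: (grad u p) => g hq hC; rewrite /= /GRing.scale/=.
  have -> : q0 * (eps * g.1) ^+ 2 + q1 * (eps * g.1 * (eps * g.2)) + q2 * (eps * g.2) ^+ 2
    = eps ^+ 2 * (q0 * g.1 ^+ 2 + q1 * (g.1 * g.2) + q2 * g.2 ^+ 2) by ring.
  rewrite -mulrA -mulrBr; apply: ler_wpM2l; first exact: sqr_ge0.
  apply: le_trans hq _; apply: le_trans hC _; rewrite lerD2l lerN2.
  have -> : e / 2 / (4 * h) ^+ 2 * \1_Z p = e / 2 * ((4 * h)^-2 * \1_Z p).
    by rewrite !mulrA.
  by apply: ler_wpM2l => //; rewrite divr_ge0// ltW.
have ZN : Z `<=` interior Omega.
  move=> p /Zu[up _]; rewrite -(scaled_cone_support cO Omega_interior hr0 eps0 ballA)/=.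
  by rewrite scaled_cone_gt0.
have := functional_scaled_cone_le cO Omega_bounded Omega_interior hr0 eps0 ballA
  f_continuous _ mZ ZN Upt.
move=> /(_ (`|f (0, 0)| + 1)) Hle; apply: le_lt_trans (Hle _) _.
  by move=> v vb; apply: Mb; rewrite subr0; exact: le_trans vb eps2.
rewrite ZE/= -/V mulrDl -addrA gtrDl.
(* The squared slope is of order [h ^ -2] and the strip has area of order [s * h], so the gain is of
   order [s / h = 1 / delta]. *)
have -> : eps ^+ 2 * k * V - eps ^+ 2 * (e / 2 / (4 * h) ^+ 2) * (s / 8 * (kap * h / 4))
   = eps ^+ 2 * (k * V - e * kap / (32 * 32 * delta)).
  by rewrite /h; field; rewrite !gt_eqF.
rewrite pmulr_rlt0 ?exprn_gt0//; apply: energy_arith => //.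
- exact: mulr_ge0.
- exact: mulr_gt0.
- by rewrite ge_min lexx.
Qed.
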